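(* For every integer $d\ge 2$, the $d$-Scattered Set problem on $n$-vertex graphs can be solved exactly in time $O^*((ed)^{\frac{2n}{d}})$.
   Context: All graphs are finite, simple and undirected. $d_G(u,v)$ is the shortest-path distance (number of edges). A $d$-scattered set of $G$ is a set $K\subseteq V(G)$ with $d_G(u,v)\ge d$ for all distinct $u,v\in K$; the $d$-Scattered Set problem asks for one of maximum size. $O^*(\cdot)$ suppresses factors polynomial in the input size; $e$ is Euler's number. *)

(* Defs.v *)
From HB Require Import structures.
From mathcomp Require Import all_boot all_order all_algebra.
From mathcomp Require Import reals sequences exp.

Set Implicit Arguments.
Unset Strict Implicit.
Unset Printing Implicit Defensive.

(** * Graphs, distance, scattered sets *)

Record sgraph := SGraph {
  nverts : nat;
  adj : rel 'I_nverts;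
  adj_sym : symmetric adj;
  adj_irrefl : irreflexive adj }.

Definition walk (G : sgraph) (u v : 'I_(nverts G)) (k : nat) : bool :=
  [exists p : k.-tuple 'I_(nverts G), path (@adj G) u p && (last u p == v)].

Lemma connect_walk (G : sgraph) (u v : 'I_(nverts G)) :
  connect (@adj G) u v -> exists k, walk u v k.
Proof.
move=> /connectP[p pth ->]; exists (size p).
by apply/existsP; exists (in_tuple p); rewrite pth eqxx.
Qed.

(** [None] stands for the distance [+oo] between vertices of distinct components. *)
Definition gdist (G : sgraph) (u v : 'I_(nverts G)) : option nat :=
  match @idP (connect (@adj G) u v) with
  | ReflectT uv => Some (ex_minn (connect_walk uv))
  | ReflectF _ => None
  end.

Definition le_dist (d : nat) (x : option nat) : bool :=
  if x is Some k then d <= k else true.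

Definition scattered (d : nat) (G : sgraph) (K : {set 'I_(nverts G)}) : Prop :=
  forall u v, u \in K -> v \in K -> u != v -> le_dist d (gdist u v).

Definition max_scattered (d : nat) (G : sgraph) (K : {set 'I_(nverts G)}) : Prop :=
  scattered d K /\
  forall K' : {set 'I_(nverts G)}, scattered d K' -> #|K'| <= #|K|.

(** * Model of computation

  A random access machine with registers, an indirectly addressed memory, and
  structured control flow (which compiles to jumps at constant-factor cost).
  The only operation that produces larger numbers is the successor. Hence after
  [t] steps every number is at most [t] plus a constant plus the largest input
  number, and charging one unit per instruction differs from charging the bit
  length of the operands only by a factor O(log (t + input)). With unit-cost
  addition on unbounded numbers this would fail for exponential [t]. *)

Record state := State { reg : nat -> nat; ram : nat -> nat }.

Definition upd (f : nat -> nat) (i a : nat) : nat -> nat :=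
  fun j => if j == i then a else f j.

Definition set_reg (s : state) (x a : nat) : state :=
  State (upd (reg s) x a) (ram s).

Definition set_ram (s : state) (i a : nat) : state :=
  State (reg s) (upd (ram s) i a).

(** [x], [y] are register names; [IfLt x y] and [WhileLt x y] test whether the
    content of [x] is smaller than the content of [y]. *)
Inductive prog :=
  | Skip
  | Const (x c : nat)
  | Copy (x y : nat)
  | Succ (x : nat)
  | Pred (x : nat)
  | Read (x y : nat)  (* x := ram[y] *)
  | Write (x y : nat) (* ram[x] := y *)
  | Seq (p q : prog)
  | IfLt (x y : nat) (p q : prog)
  | WhileLt (x y : nat) (p : prog).

(** [exec p s t s']: started in [s], [p] halts in [s'] after [t] steps. *)
Inductive exec : prog -> state -> nat -> state -> Prop :=
  | exec_Skip s : exec Skip s 1 s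
  | exec_Const s x c : exec (Const x c) s 1 (set_reg s x c)
  | exec_Copy s x y : exec (Copy x y) s 1 (set_reg s x (reg s y))
  | exec_Succ s x : exec (Succ x) s 1 (set_reg s x (reg s x).+1)
  | exec_Pred s x : exec (Pred x) s 1 (set_reg s x (reg s x).-1)
  | exec_Read s x y : exec (Read x y) s 1 (set_reg s x (ram s (reg s y)))
  | exec_Write s x y : exec (Write x y) s 1 (set_ram s (reg s x) (reg s y))
  | exec_Seq p q s1 s2 s3 t1 t2 :
      exec p s1 t1 s2 -> exec q s2 t2 s3 -> exec (Seq p q) s1 (t1 + t2) s3
  | exec_IfTrue x y p q s t s' :
      reg s x < reg s y -> exec p s t s' -> exec (IfLt x y p q) s t.+1 s'
  | exec_IfFalse x y p q s t s' :
      reg s y <= reg s x -> exec q s t s' -> exec (IfLt x y p q) s t.+1 s'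
  | exec_WhileDone x y p s :
      reg s y <= reg s x -> exec (WhileLt x y p) s 1 s
  | exec_WhileStep x y p s1 s2 s3 t1 t2 :
      reg s1 x < reg s1 y -> exec p s1 t1 s2 -> exec (WhileLt x y p) s2 t2 s3 ->
      exec (WhileLt x y p) s1 (t1 + t2).+1 s3.

Lemma exec_det p s t1 s1 t2 s2 :
  exec p s t1 s1 -> exec p s t2 s2 -> t1 = t2 /\ s1 = s2.
Proof.
move=> H; elim: H t2 s2 => {p s t1 s1}.
1-7: by intros; match goal with H : exec _ _ _ _ |- _ => inversion H end.
- move=> p q s1 s2 s3 t1 t2 _ IH1 _ IH2 t s H.
  inversion H as [| | | | | | |? ? ? s2' ? t1' t2' E1 E2| | | |]; subst.
  by case: (IH1 _ _ E1) => ? ?; subst; case: (IH2 _ _ E2) => -> ->.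
- move=> x y p q s t s' lt_xy _ IH t2 s2 H.
  inversion H as [| | | | | | | |? ? ? ? ? ? ? L E|? ? ? ? ? ? ? L E| |]; subst.
    by case: (IH _ _ E) => -> ->.
  by move: L; rewrite leqNgt lt_xy.
- move=> x y p q s t s' le_yx _ IH t2 s2 H.
  inversion H as [| | | | | | | |? ? ? ? ? ? ? L E|? ? ? ? ? ? ? L E| |]; subst.
    by move: L; rewrite ltnNge le_yx.
  by case: (IH _ _ E) => -> ->.
- move=> x y p s le_yx t2 s2 H.
  inversion H as [| | | | | | | | | | |? ? ? ? ? ? ? ? L E1 E2]; subst => //.
  by move: L; rewrite ltnNge le_yx.
- move=> x y p s1 s2 s3 t1 t2 lt_xy _ IH1 _ IH2 t s H.
  inversion H as [| | | | | | | | | |? ? ? ? L|? ? ? ? ? ? ? ? L E1 E2]; subst.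
    by move: L; rewrite leqNgt lt_xy.
  by case: (IH1 _ _ E1) => ? ?; subst; case: (IH2 _ _ E2) => -> ->.
Qed.

Definition start (w : seq nat) : state := State (fun _ => 0) (nth 0 w).

(** [O^*(f)]-time solvability of a search problem: instances [x] are presented
    as the word [enc x], whose length is the input size, and [sol x s] says that
    the final state [s] carries a correct answer for [x]. *)
Definition solvable_Ostar (R : realType) (I : Type) (enc : I -> seq nat)
    (sol : I -> state -> Prop) (f : I -> R) : Prop :=
  exists (prg : prog) (p : {poly nat}), forall x : I,
    exists (t : nat) (s : state),
      [/\ exec prg (start (enc x)) t s,
          sol x s &
          (t%:R <= (p.[size (enc x)])%:R * f x)%R].

(** * The d-Scattered Set problem *)

(** The number of vertices followed by the adjacency matrix, row by row. *)
Definition encode (G : sgraph) : seq nat :=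
  nverts G :: [seq nat_of_bool (adj i j) | i <- enum 'I_(nverts G),
                                          j <- enum 'I_(nverts G)].

(** The answer is the vertex set whose characteristic vector is stored in the
    first [nverts G] memory cells. *)
Definition answer (G : sgraph) (s : state) : {set 'I_(nverts G)} :=
  [set i : 'I_(nverts G) | ram s i != 0].

Definition solves_scattered (d : nat) (G : sgraph) (s : state) : Prop :=
  max_scattered d (answer G s).

(* Main.v *)
Require Import Defs.
From mathcomp Require Import all_boot all_order all_algebra.
From mathcomp Require Import reals sequences exp.
From mathcomp Require Import zify.

(** Put [r = (d-1)/2] and let [K] be a scattered set. The balls of radius [r]
    around [K] are disjoint, so at most [2n/d] vertices of [K] have a ball with
    at least [d/2] vertices; call their set [X]. Balls grow by at least one
    vertex per step until they fill a component, so around each other vertex of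
    [K] the ball is a whole component. Any maximal scattered set containing [X]
    meets each of these components, so it is at least as large as [K].

    The program therefore enumerates all vertex sets of size at most [2n/d],
    extends each greedily to a maximal scattered set (considering the vertices
    of the enumerated set first) and keeps the largest result. The number of
    enumerated sets [X] is at most
    [sum_X d^(2n/d - |X|) <= d^(2n/d) (1 + 1/d)^n <= (e d)^(2n/d)]. *)

Set Implicit Arguments.
Unset Strict Implicit.
Unset Printing Implicit Defensive.

(** * Running time of machine programs *)

(** The time bound leaves no room for walking through all [2 ^ n] bit vectors and discarding the
    heavy ones, so the enumeration has to jump from one light vector to the next. Vectors are read
    as binary numbers. If one more set bit is affordable, the next number is taken; otherwise the
    lowest set bit is added, and every number jumped over is too heavy. Each round of the outer loop
    thus uses up a light vector of its own.

    The machine has neither addition nor multiplication, yet a round must take polynomially many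
    steps. Rounds are therefore written in a small language whose loops all range over [n], so that
    a time bound can be read off the syntax; only the loop over the vectors is unbounded. *)

Definition runs (p : prog) (s : state) (T : nat) (Q : state -> Prop) : Prop :=
  exists t s', [/\ exec p s t s', t <= T & Q s'].

Lemma runs_weaken p s T T' (Q Q' : state -> Prop) :
  runs p s T Q -> T <= T' -> (forall s', Q s' -> Q' s') -> runs p s T' Q'.
Proof.
move=> [t [s' [ex le q]]] leT QQ'; exists t, s'.
by split=> //; [apply: leq_trans le leT | apply: QQ'].
Qed.

Lemma runs_seq p q s T1 T2 (Q1 Q : state -> Prop) :
  runs p s T1 Q1 -> (forall s', Q1 s' -> runs q s' T2 Q) ->
  runs (Seq p q) s (T1 + T2) Q.
Proof.
move=> [t1 [s1 [ex1 le1 q1]]] /(_ _ q1) [t2 [s2 [ex2 le2 q2]]].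
by exists (t1 + t2), s2; split=> //; [apply: exec_Seq ex1 ex2 | apply: leq_add].
Qed.

Lemma runs_const x c s (Q : state -> Prop) :
  Q (set_reg s x c) -> runs (Const x c) s 1 Q.
Proof. by move=> q; exists 1, (set_reg s x c); split=> //; constructor. Qed.

Lemma runs_copy x y s (Q : state -> Prop) :
  Q (set_reg s x (reg s y)) -> runs (Copy x y) s 1 Q.
Proof. by move=> q; exists 1, (set_reg s x (reg s y)); split=> //; constructor. Qed.

Lemma runs_succ x s (Q : state -> Prop) :
  Q (set_reg s x (reg s x).+1) -> runs (Succ x) s 1 Q.
Proof. by move=> q; exists 1, (set_reg s x (reg s x).+1); split=> //; constructor. Qed.

Lemma runs_read x y s (Q : state -> Prop) :
  Q (set_reg s x (ram s (reg s y))) -> runs (Read x y) s 1 Q.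
Proof.
by move=> q; exists 1, (set_reg s x (ram s (reg s y))); split=> //; constructor.
Qed.

Lemma runs_write x y s (Q : state -> Prop) :
  Q (set_ram s (reg s x) (reg s y)) -> runs (Write x y) s 1 Q.
Proof.
by move=> q; exists 1, (set_ram s (reg s x) (reg s y)); split=> //; constructor.
Qed.

Lemma runs_skip s (Q : state -> Prop) : Q s -> runs Skip s 1 Q.
Proof. by move=> q; exists 1, s; split=> //; constructor. Qed.

Lemma runs_if x y p q s T (Q : state -> Prop) :
  (reg s x < reg s y -> runs p s T Q) -> (reg s y <= reg s x -> runs q s T Q) ->
  runs (IfLt x y p q) s T.+1 Q.
Proof.
move=> Hp Hq; case: (ltnP (reg s x) (reg s y)) => xy.
  have [t [s' [ex le q']]] := Hp xy; exists t.+1, s'.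
  by split=> //; apply: exec_IfTrue.
have [t [s' [ex le q']]] := Hq xy; exists t.+1, s'.
by split=> //; apply: exec_IfFalse.
Qed.

Definition Loop i y p := Seq (Const i 0) (WhileLt i y (Seq p (Succ i))).

(** Each round pays for the body, one increment and one test, hence [T.+2]; the final 2 is the
    initial [Const] and the failing last test. Since [I j] fixes register [i] to [j], the body has
    to leave the counter intact. *)
Lemma runs_loop i y p N T (I : nat -> state -> Prop) (s : state) :
  (forall j s', I j s' -> reg s' i = j /\ reg s' y = N) ->
  (forall j s', j < N -> I j s' ->
     runs p s' T (fun s'' => I j.+1 (set_reg s'' i (reg s'' i).+1))) ->
  I 0 (set_reg s i 0) ->
  runs (Loop i y p) s (N * T.+2 + 2) (I N).
Proof.
move=> Ireg step I0.
have loop m k s' : k + m = N -> I k s' ->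
    runs (WhileLt i y (Seq p (Succ i))) s' (m * T.+2 + 1) (I N).
  elim: m k s' => [|m IH] k s' kmN Ik.
    have [ri ry] := Ireg _ _ Ik.
    rewrite addn0 in kmN; exists 1, s'; split=> //; last by rewrite -kmN.
    by apply: exec_WhileDone; rewrite ri ry kmN.
  have [ri ry] := Ireg _ _ Ik.
  have kN : k < N by rewrite -kmN -addSnnS leq_addr.
  have [t1 [s1 [ex1 le1 I1]]] := step _ _ kN Ik.
  have [|t2 [s2 [ex2 le2 I2]]] := IH k.+1 _ _ I1; first by rewrite addSnnS.
  exists (t1 + 1 + t2).+1, s2; split=> //; last by lia.
  apply: exec_WhileStep ex2; first by rewrite ri ry.
  by apply: exec_Seq ex1 _; constructor.
have -> : N * T.+2 + 2 = 1 + (N * T.+2 + 1) by lia.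
apply: runs_seq (fun _ => id).
by apply: runs_const; apply: (loop N 0).
Qed.

(** The machine only counts, so the address is counted up in register 0, with 1 and 2 as loop
    counters. It starts at 1 because the input has the number of vertices in cell 0. *)
Definition Addr (r i : nat) : prog :=
  Seq (Const 0 1) (Seq (Loop 1 r (Loop 2 3 (Succ 0))) (Loop 1 i (Succ 0))).

Definition same_above2 (s s' : state) : Prop :=
  ram s' = ram s /\ forall x, 2 < x -> reg s' x = reg s x.

Definition addr_time (n a b : nat) := 1 + (a * (n * 3 + 2).+3 + 2 + (b * 3 + 2)).

Lemma runs_addr n r i s :
  2 < r -> 2 < i -> reg s 3 = n ->
  runs (Addr r i) s (addr_time n (reg s r) (reg s i))
    (fun s' => same_above2 s s' /\ reg s' 0 = 1 + reg s r * n + reg s i).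
Proof.
move=> r2 i2 sn.
have regU f k v x : x != k -> upd f k v x = f x by rewrite /upd => /negPf->.
apply: runs_seq (fun s' => id) => //.
apply: runs_const.
apply: (@runs_seq _ _ _ _ _ (fun s' => same_above2 s s' /\ reg s' 0 = 1 + reg s r * n)).
  apply: (@runs_weaken _ _ _ _ (fun s' =>
    [/\ same_above2 s s', reg s' 0 = 1 + reg s r * n & reg s' 1 = reg s r])).
    apply: (@runs_loop _ _ _ _ _ (fun j s' =>
      [/\ same_above2 s s', reg s' 0 = 1 + j * n & reg s' 1 = j])).
    - by move=> j s' [[_ E] _ ->]; rewrite E.
    - move=> j s' jr [[M E] r0 r1].
      apply: (@runs_weaken _ _ _ _ (fun s' => [/\ same_above2 s s',
        reg s' 0 = 1 + j * n + n, reg s' 1 = j & reg s' 2 = n])).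
        apply: (@runs_loop _ _ _ _ _ (fun k s' => [/\ same_above2 s s',
          reg s' 0 = 1 + j * n + k, reg s' 1 = j & reg s' 2 = k])).
        + by move=> k s2 [[_ E'] _ _ ->]; rewrite E'.
        + move=> k s2 kn [[M' E'] r0' r1' r2']; apply: runs_succ.
          split=> /=; try by rewrite /upd /=; lia.
          by split=> //= x x2; rewrite !regU ?E' //; lia.
        + split=> //=; first by split=> //= x x2; rewrite !regU ?E //; lia.
          by rewrite /upd /= r0 addn0.
      + by [].
      + move=> s2 [[M' E'] r0' r1' r2'] /=.
        split=> /=; try by rewrite /upd /=; lia.
        by split=> //= x x2; rewrite !regU ?E' //; lia.
    - split=> //=; first by split=> //= x x2; rewrite !regU //; lia.
  - by [].
  - by move=> s' [].
move=> s1 [[M E] r0].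
apply: (@runs_weaken _ _ _ _ (fun s' => [/\ same_above2 s s',
  reg s' 0 = 1 + reg s r * n + reg s i & reg s' 1 = reg s i])).
  apply: (@runs_loop _ _ _ _ _ (fun j s' =>
    [/\ same_above2 s s', reg s' 0 = 1 + reg s r * n + j & reg s' 1 = j])).
  - by move=> j s' [[_ E'] _ ->]; rewrite E'.
  - move=> j s' ji [[M' E'] r0' r1']; apply: runs_succ.
    split=> /=; try by rewrite /upd /=; lia.
    by split=> //= x x2; rewrite !regU ?E' //; lia.
  - split=> //=; first by split=> //= x x2; rewrite !regU ?E //; lia.
    by rewrite /upd /= r0 addn0.
- by [].
- by move=> s' [].
Qed.

(** * A total language with polynomial running time *)

Record hstate := HState { hreg : nat -> nat; hmem : nat -> nat -> nat }.

Definition hset (h : hstate) (x a : nat) : hstate := HState (upd (hreg h) x a) (hmem h).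

Definition hput (h : hstate) (r i a : nat) : hstate :=
  HState (hreg h) (fun r' i' => if (r' == r) && (i' == i) then a else hmem h r' i').

Inductive hprog :=
  | HSkip
  | HConst (x c : nat)
  | HCopy (x y : nat)
  | HSucc (x : nat)
  | HLoad (x r i : nat)
  | HStore (r i y : nat)
  | HSeq (p q : hprog)
  | HIf (x y : nat) (p q : hprog)
  | HFor (i : nat) (p : hprog).

(** Loads and stores out of range do nothing. These guards bound the numbers that [Addr] counts up
    to, so the cost of an access is bounded in terms of [n] alone and [htime] needs no knowledge of
    the state. [HFor] ends with its register at [n], as the compiled loop does. *)
Fixpoint den (n : nat) (p : hprog) (h : hstate) : hstate :=
  match p with
  | HSkip => h
  | HConst x c => hset h x c
  | HCopy x y => hset h x (hreg h y)
  | HSucc x => hset h x (hreg h x).+1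
  | HLoad x r i =>
      if (hreg h i < n) && (hreg h r < n + 4)
      then hset h x (hmem h (hreg h r) (hreg h i)) else h
  | HStore r i y =>
      if (hreg h i < n) && (hreg h r < n + 4)
      then hput h (hreg h r) (hreg h i) (hreg h y) else h
  | HSeq p q => den n q (den n p h)
  | HIf x y p q => if hreg h x < hreg h y then den n p h else den n q h
  | HFor i p => hset (iteri n (fun k h' => den n p (hset h' i k)) h) i n
  end.

Fixpoint writes (p : hprog) (x : nat) : bool :=
  match p with
  | HSkip | HStore _ _ _ => false
  | HConst y _ | HCopy y _ | HSucc y | HLoad y _ _ => x == y
  | HSeq p q | HIf _ _ p q => writes p x || writes q x
  | HFor i p => (x == i) || writes p x
  end.

(** A body that wrote its own loop register could change the number of rounds; excluding this makes
    the compiled [WhileLt] run exactly [n] times. *)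
Fixpoint wf (p : hprog) : bool :=
  match p with
  | HSeq p q | HIf _ _ p q => wf p && wf q
  | HFor i p => ~~ writes p i && wf p
  | _ => true
  end.

(** Machine registers 0, 1, 2 are scratch, 3 holds [n], 4 holds [n + 4], and
    register [x] of the language is machine register [x + 5]. *)
Fixpoint compile (p : hprog) : prog :=
  match p with
  | HSkip => Skip
  | HConst x c => Const (x + 5) c
  | HCopy x y => Copy (x + 5) (y + 5)
  | HSucc x => Succ (x + 5)
  | HLoad x r i =>
      IfLt (i + 5) 3
        (IfLt (r + 5) 4 (Seq (Addr (r + 5) (i + 5)) (Read (x + 5) 0)) Skip) Skip
  | HStore r i y =>
      IfLt (i + 5) 3
        (IfLt (r + 5) 4 (Seq (Addr (r + 5) (i + 5)) (Write 0 (y + 5))) Skip) Skip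
  | HSeq p q => Seq (compile p) (compile q)
  | HIf x y p q => IfLt (x + 5) (y + 5) (compile p) (compile q)
  | HFor i p => Loop (i + 5) 3 (compile p)
  end.

Fixpoint htime (p : hprog) (n : nat) : nat :=
  match p with
  | HSkip | HConst _ _ | HCopy _ _ | HSucc _ => 1
  | HLoad _ _ _ | HStore _ _ _ => addr_time n (n + 4) n + 3
  | HSeq p q => htime p n + htime q n
  | HIf _ _ p q => htime p n + htime q n + 1
  | HFor _ p => n * (htime p n + 2) + 2
  end.

(** With rows at addresses [1 + r * n], the rows below [n] are the adjacency
    matrix of the input. *)
Definition represents (n : nat) (h : hstate) (s : state) : Prop :=
  [/\ reg s 3 = n, reg s 4 = n + 4, forall x, reg s (x + 5) = hreg h x &
      forall r i, i < n -> ram s (1 + r * n + i) = hmem h r i].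

Lemma addr_inj n r i r' i' : i < n -> i' < n ->
  (1 + r * n + i == 1 + r' * n + i') = (r == r') && (i == i').
Proof.
move=> lti lti'; apply/eqP/andP => [E|[/eqP-> /eqP->] //].
have n0 : 0 < n by lia.
have E' : r * n + i = r' * n + i' by lia.
have := congr1 (divn^~ n) E'; rewrite !divnMDl // !divn_small // !addn0 => rr.
by move: E'; rewrite rr => /addnI->; rewrite !eqxx.
Qed.

Lemma represents_set n h s x a :
  represents n h s -> represents n (hset h x a) (set_reg s (x + 5) a).
Proof.
move=> [s3 s4 sr sm]; split=> //=.
- by rewrite /upd ifN //; lia.
- by rewrite /upd ifN //; lia.
- by move=> y; rewrite /upd eqn_add2r sr.
Qed.

Lemma represents_put n h s r i a : i < n ->
  represents n h s -> represents n (hput h r i a) (set_ram s (1 + r * n + i) a).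
Proof.
move=> lti [s3 s4 sr sm]; split=> //= r' i' lti'.
by rewrite /upd addr_inj // sm.
Qed.

Lemma represents_above2 n h s s' :
  represents n h s -> same_above2 s s' -> represents n h s'.
Proof.
move=> [s3 s4 sr sm] [M E]; split; rewrite ?E ?M //.
by move=> x; rewrite E ?sr //; lia.
Qed.

Lemma iteri_hset_frame n p i k h x : x != i ->
  (forall h', hreg (den n p h') x = hreg h' x) ->
  hreg (iteri k (fun k h' => den n p (hset h' i k)) h) x = hreg h x.
Proof.
by move=> /negPf xi E; elim: k => //= k IH; rewrite E /= /upd xi IH.
Qed.

Lemma den_frame n p x h : ~~ writes p x -> hreg (den n p h) x = hreg h x.
Proof.
elim: p h => //=.
- by move=> y c h /negPf yx; rewrite /upd yx.
- by move=> y z h /negPf yx; rewrite /upd yx.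
- by move=> y h /negPf yx; rewrite /upd yx.
- by move=> y r i h /negPf yx; case: ifP => //= _; rewrite /upd yx.
- by move=> r i y h _; case: ifP.
- by move=> p IHp q IHq h /norP[wp wq]; rewrite IHq // IHp.
- by move=> y z p IHp q IHq h /norP[wp wq]; case: ifP => _; rewrite (IHp, IHq).
- move=> i p IH h /norP[xi wp]; rewrite /upd (negPf xi).
  by rewrite iteri_hset_frame // => h'; apply: IH.
Qed.

Lemma addr_time_mono n a b a' b' :
  a <= a' -> b <= b' -> addr_time n a b <= addr_time n a' b'.
Proof. by move=> aa bb; rewrite /addr_time !(leq_add, leq_mul). Qed.

Lemma runs_compile n p h s : wf p -> represents n h s ->
  runs (compile p) s (htime p n) (represents n (den n p h)).
Proof.
elim: p h s => /=.
- by move=> h s _ rep; apply: runs_skip.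
- by move=> x c h s _ rep; apply: runs_const; apply: represents_set.
- move=> x y h s _ rep; apply: runs_copy.
  by have [_ _ -> _] := rep; apply: represents_set.
- move=> x h s _ rep; apply: runs_succ.
  by have [_ _ -> _] := rep; apply: represents_set.
- move=> x r i h s _ rep; have [s3 s4 sr sm] := rep.
  rewrite addn3; apply: runs_if; rewrite s3 sr; [move=> lti|]; last first.
    rewrite leqNgt => /negPf->.
    by apply: runs_weaken (runs_skip rep) _ (fun _ => id).
  apply: runs_if; rewrite s4 sr; [move=> ltr|]; last first.
    rewrite leqNgt andbC => /negPf->.
    by apply: runs_weaken (runs_skip rep) _ (fun _ => id).
  rewrite lti ltr /= -[X in runs _ _ X]addn1.
  apply: (@runs_seq _ _ _ _ _ (fun s' => same_above2 s s' /\
    reg s' 0 = 1 + hreg h r * n + hreg h i)).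
    have := @runs_addr n (r + 5) (i + 5) s; rewrite !sr s3 => H.
    apply: runs_weaken (H _ _ _) _ (fun _ => id) => //; try by lia.
    by apply: addr_time_mono; apply: ltnW.
  move=> s' [E s0]; apply: runs_read; rewrite s0.
  have rep' := represents_above2 rep E; have [_ _ _ ->//] := rep'.
  exact: represents_set.
- move=> r i y h s _ rep; have [s3 s4 sr sm] := rep.
  rewrite addn3; apply: runs_if; rewrite s3 sr; [move=> lti|]; last first.
    rewrite leqNgt => /negPf->.
    by apply: runs_weaken (runs_skip rep) _ (fun _ => id).
  apply: runs_if; rewrite s4 sr; [move=> ltr|]; last first.
    rewrite leqNgt andbC => /negPf->.
    by apply: runs_weaken (runs_skip rep) _ (fun _ => id).
  rewrite lti ltr /= -[X in runs _ _ X]addn1.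
  apply: (@runs_seq _ _ _ _ _ (fun s' => same_above2 s s' /\
    reg s' 0 = 1 + hreg h r * n + hreg h i)).
    have := @runs_addr n (r + 5) (i + 5) s; rewrite !sr s3 => H.
    apply: runs_weaken (H _ _ _) _ (fun _ => id) => //; try by lia.
    by apply: addr_time_mono; apply: ltnW.
  move=> s' [E s0]; apply: runs_write; rewrite s0.
  have rep' := represents_above2 rep E; have [_ _ -> _] := rep'.
  exact: represents_put.
- move=> p IHp q IHq h s /andP[wp wq] rep.
  by apply: runs_seq (IHp _ _ wp rep) _ => s' rep'; apply: IHq.
- move=> x y p IHp q IHq h s /andP[wp wq] rep; have [_ _ sr _] := rep.
  rewrite addn1; apply: runs_if; rewrite !sr => lt.
    by rewrite lt; apply: runs_weaken (IHp _ _ wp rep) _ (fun _ => id); lia.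
  rewrite ltnNge lt.
  by apply: runs_weaken (IHq _ _ wq rep) _ (fun _ => id); lia.
- move=> i p IH h s /andP[wi wp] rep; rewrite (addn2 (htime p n)).
  apply: (@runs_loop _ _ _ _ _ (fun j s' => represents n
     (hset (iteri j (fun k h' => den n p (hset h' i k)) h) i j) s')).
  + by move=> j s' [s3 _ sr _]; rewrite s3 sr /= /upd eqxx.
  + move=> j s' ltj rep'.
    apply: runs_weaken (IH _ _ wp rep') _ _ => // s2 rep2 /=.
    have [_ _ sr _] := rep2; rewrite sr.
    (* By [wf] the body has left the loop register at [j], so the machine's increment yields
       [j.+1]. *)
    by rewrite den_frame //= /upd eqxx; apply: represents_set.
  + exact: represents_set.
Qed.

(** * Polynomial bounds on running times *)

Definition poly_bounded (f : nat -> nat) : Prop :=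
  exists p : {poly nat}, forall n, f n <= p.[n]%R.

Lemma poly_bounded_const c : poly_bounded (fun=> c).
Proof. by exists (c%:P)%R => n; rewrite hornerC. Qed.

Lemma poly_bounded_id : poly_bounded id.
Proof. by exists 'X%R => n; rewrite hornerX. Qed.

Lemma poly_bounded_add f g :
  poly_bounded f -> poly_bounded g -> poly_bounded (fun n => f n + g n).
Proof.
move=> [p Hp] [q Hq]; exists (p + q)%R => n; rewrite hornerD.
exact: leq_add.
Qed.

Lemma poly_bounded_mul f g :
  poly_bounded f -> poly_bounded g -> poly_bounded (fun n => f n * g n).
Proof.
move=> [p Hp] [q Hq]; exists (p * q)%R => n; rewrite hornerM.
exact: leq_mul.
Qed.

Lemma poly_bounded_le f g :
  (forall n, f n <= g n) -> poly_bounded g -> poly_bounded f.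
Proof. by move=> fg [p Hp]; exists p => n; apply: leq_trans (fg n) (Hp n). Qed.

(** All coefficients are natural numbers, so nothing decreases. This turns a bound in the number of
    vertices into one in the length of the encoding. *)
Lemma poly_nat_mono (p : {poly nat}) m n : m <= n -> p.[m]%R <= p.[n]%R.
Proof.
move=> mn; elim/poly_ind: p => [|p c IH]; first by rewrite !horner0.
by rewrite !hornerE; apply: leq_add => //; apply: leq_mul.
Qed.

Ltac poly_bound :=
  repeat first [ apply: poly_bounded_add | apply: poly_bounded_mul
               | apply: poly_bounded_const | apply: poly_bounded_id ].

Lemma poly_bounded_addr_time k c :
  poly_bounded (fun n => addr_time n (n + k) n + c).
Proof.
apply: (@poly_bounded_le _
  (fun n => (1 + ((n + k) * (n * 3 + 5) + 2 + (n * 3 + 2))) + c)).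
  by move=> n; rewrite /addr_time; nia.
by poly_bound.
Qed.

Lemma poly_bounded_htime p : poly_bounded (htime p).
Proof.
elim: p => /=; intros; try exact: poly_bounded_const.
- exact: poly_bounded_addr_time.
- exact: poly_bounded_addr_time.
- exact: poly_bounded_add.
- by poly_bound.
- by poly_bound.
Qed.

(** * The greedy extension *)

(** Registers that the body never writes come for free, in each round and at the end, so [I] only
    has to describe what the loop changes. *)
Lemma for_ind n i p h (I : nat -> hstate -> Prop) :
  I 0 h ->
  (forall k h', k < n ->
     (forall x, x != i -> ~~ writes p x -> hreg h' x = hreg h x) ->
     I k h' -> I k.+1 (den n p (hset h' i k))) ->
  exists h', [/\ den n (HFor i p) h = hset h' i n,
    forall x, x != i -> ~~ writes p x -> hreg h' x = hreg h x & I n h'].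
Proof.
move=> I0 step; pose F k h' := den n p (hset h' i k).
have fr k x : x != i -> ~~ writes p x -> hreg (iteri k F h) x = hreg h x.
  by move=> xi wx; apply: iteri_hset_frame => // h'; apply: den_frame.
exists (iteri n F h); split=> //; first exact: fr.
suff : forall k, k <= n -> I k (iteri k F h) by apply.
elim=> // k IH kn; apply: step => //; last by apply: IH; apply: ltnW.
exact: fr.
Qed.

Lemma den_load n x r i h : hreg h i < n -> hreg h r < n + 4 ->
  den n (HLoad x r i) h = hset h x (hmem h (hreg h r) (hreg h i)).
Proof. by move=> /= -> ->. Qed.

Lemma den_store n r i y h : hreg h i < n -> hreg h r < n + 4 ->
  den n (HStore r i y) h = hput h (hreg h r) (hreg h i) (hreg h y).
Proof. by move=> /= -> ->. Qed.

Lemma hregE h x a y : hreg (hset h x a) y = if y == x then a else hreg h y.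
Proof. by []. Qed.

Lemma den_seq n p q h : den n (HSeq p q) h = den n q (den n p h).
Proof. by []. Qed.

Lemma den_if n x y p q h :
  den n (HIf x y p q) h = if hreg h x < hreg h y then den n p h else den n q h.
Proof. by []. Qed.

(** Registers 0 to 3 hold the numbers of the four work rows: the enumerated
    vector, the blocked vertices, the greedy set and the best set so far. *)
Definition env (n : nat) (h : hstate) : Prop :=
  forall x, x < 8 ->
    hreg h x = nth 0 [:: n; n + 1; n + 2; n + 3; 1; 0; (n + n).+1; 2] x.

Lemma env_frame n h h' :
  (forall x, x < 8 -> hreg h' x = hreg h x) -> env n h -> env n h'.
Proof. by move=> E e x x8; rewrite E // e. Qed.

Lemma env_hset n h x a : 8 <= x -> env n h -> env n (hset h x a).
Proof.
move=> x8; apply: env_frame => y y8 /=; rewrite /upd ifN //.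
by apply/eqP => yx; move: y8; rewrite yx ltnNge x8.
Qed.

Lemma env_hput n h r i a : env n h -> env n (hput h r i a).
Proof. exact: env_frame. Qed.

Lemma env_den n p h : (forall x, x < 8 -> ~~ writes p x) -> env n h -> env n (den n p h).
Proof. by move=> wp; apply: env_frame => x x8; apply: den_frame (wp _ x8). Qed.

Lemma iota0S k : iota 0 k.+1 = rcons (iota 0 k) k.
Proof. by rewrite -addn1 iotaD cats1. Qed.

Section Greedy.

Variables (n : nat) (a : nat -> nat -> bool).

Fixpoint reach (k u i : nat) : bool :=
  (i == u) || (if k is k'.+1 then has (fun v => a u v && reach k' v i) (iota 0 n)
               else false).

Lemma reach_refl k u : reach k u u.
Proof. by case: k => [|k] /=; rewrite eqxx. Qed.

Definition holds_adj (h : hstate) : Prop :=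
  forall u v, u < n -> v < n -> hmem h u v = a u v.

(** Level [k] keeps its current vertex in register [20 + k]. The [k] nested loops
    take time of order [n ^ k], which is polynomial because [k < d] is fixed. *)
Fixpoint mark (k : nat) : hprog :=
  if k is k'.+1 then
    HSeq (HStore 1 (20 + k) 4)
      (HFor (20 + k')
         (HSeq (HLoad 9 (20 + k) (20 + k')) (HIf 5 9 (mark k') HSkip)))
  else HStore 1 20 4.

Lemma mark_writes k x : x != 9 -> ~~ (20 <= x < 20 + k) -> ~~ writes (mark k) x.
Proof.
move=> x9; elim: k => //= k IH xk.
rewrite (negPf x9) orbF negb_or IH ?andbT; last by apply: contra xk; lia.
by apply: contra xk => /eqP->; lia.
Qed.

Lemma wf_mark k : wf (mark k).
Proof.
elim: k => [|k IH] /=; first by [].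
by rewrite /= orbF IH !andbT mark_writes //; lia.
Qed.

Lemma den_mark k h :
  env n h -> holds_adj h -> hreg h (20 + k) < n ->
  forall r i, i < n ->
    hmem (den n (mark k) h) r i =
      if (r == n + 1) && reach k (hreg h (20 + k)) i then 1 else hmem h r i.
Proof.
elim: k h => [|k IH] h e hadj ltu r i lti.
  rewrite [mark 0]/= den_store //=; last by rewrite (e 1) //=; lia.
  by rewrite (e 1) // (e 4) //= orbF.
set u := hreg h _ in ltu *.
rewrite [mark _]/= den_seq den_store //; last by rewrite (e 1) //=; lia.
rewrite (e 1) // (e 4) // [nth _ _ _]/= [nth _ _ 4]/=.
set h1 := hput _ _ _ _.
(* What has been marked once the neighbours of [u] below [j] are explored; at [j = n] this is
   [reach k.+1 u]. *)
pose cond j i := (i == u) || has (fun v => a u v && reach k v i) (iota 0 j).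
have [||h' [-> _ I]] := @for_ind n (20 + k)
   (HSeq (HLoad 9 (20 + k.+1) (20 + k)) (HIf 5 9 (mark k) HSkip)) h1
   (fun j h' => forall r i, i < n ->
      hmem h' r i = if (r == n + 1) && cond j i then 1 else hmem h r i).
- by move=> r' i' lti'; rewrite /cond /= orbF.
- move=> j h' ltj fr I.
  have fr' x : x < 8 -> hreg h' x = hreg h x.
    move=> x8; apply: fr; first by lia.
    by apply/norP; split=> //=; rewrite ?orbF ?mark_writes //; lia.
  have e' : env n h' by apply: env_frame e.
  have u' : hreg h' (20 + k.+1) = u.
    apply: fr; first by lia.
    by apply/norP; split=> //=; rewrite ?orbF ?mark_writes //; lia.
  have u1 : (20 + k.+1 == 20 + k) = false by lia.
  have [k9 k5] : (20 + k == 9) = false /\ (5 == 20 + k) = false by lia.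
  rewrite den_seq den_load !hregE ?eqxx ?u1 ?u' //; last by lia.
  rewrite den_if !hregE k5 (e' 5) // eqxx [hmem _ _ _]/=.
  (* Marks go to row [n + 1] only and [u < n], so the adjacency row is still intact. *)
  have -> : hmem h' u j = a u j.
    rewrite I // ifN ?hadj // negb_and; apply/orP; left; lia.
  have condS i' : cond j.+1 i' = cond j i' || (a u j && reach k j i').
    by rewrite /cond iota0S has_rcons [_ && _ || _]orbC orbA.
  move=> r' i' lti'; rewrite condS.
  case: (boolP (a u j)) => auj /=; last by rewrite orbF I.
  rewrite IH ?hregE ?k9 ?eqxx //.
  + rewrite [hmem (hset _ _ _) _ _]/=.
    by rewrite I //; case: (r' == n + 1) => //=; case: (cond j i'); case: reach.
  + by apply: env_hset => //; apply: env_hset => //; lia.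
  + move=> u2 v2 ltu2 ltv2 /=; rewrite I // ifN ?hadj //.
    by rewrite negb_and; apply/orP; left; lia.
by rewrite /= I.
Qed.

Variable D : nat.

Definition gtry (K : seq nat) (v : nat) : seq nat :=
  if has (fun u => reach D u v) K then K else v :: K.

Definition holds_greedy (h : hstate) (K : seq nat) : Prop :=
  [/\ forall i, i < n -> hmem h (n + 1) i = has (fun u => reach D u i) K,
      forall i, i < n -> hmem h (n + 2) i = (i \in K) &
      hreg h 10 = size K].

Definition same_rest (h h' : hstate) : Prop :=
  forall r i, i < n -> r != n + 1 -> r != n + 2 -> hmem h' r i = hmem h r i.

Lemma same_rest_trans h1 h2 h3 :
  same_rest h1 h2 -> same_rest h2 h3 -> same_rest h1 h3.
Proof. by move=> E1 E2 r i lti r1 r2; rewrite E2 // E1. Qed.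

Lemma same_rest_adj h h' : same_rest h h' -> holds_adj h -> holds_adj h'.
Proof. by move=> E A u v ltu ltv; rewrite E ?A //; lia. Qed.

(** Register 8 holds the candidate and 10 the size of the set. Accepting a vertex marks everything
    within distance [D] of it as blocked, so the test against the whole set is a single lookup. *)
Definition try_vertex : hprog :=
  HSeq (HLoad 9 1 8)
    (HIf 9 4 (HSeq (HStore 2 8 4) (HSeq (HSucc 10) (HSeq (HCopy (20 + D) 8) (mark D))))
       HSkip).

Lemma try_writes x : x != 9 -> x != 10 -> ~~ (20 <= x < 20 + D.+1) ->
  ~~ writes try_vertex x.
Proof.
move=> x9 x10 xD; rewrite /= (negPf x9) (negPf x10) orbF /= negb_or.
rewrite mark_writes ?andbT //; first by apply: contra xD => /eqP->; lia.
by apply: contra xD; lia.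
Qed.

Lemma den_try h K :
  env n h -> holds_adj h -> hreg h 8 < n -> holds_greedy h K ->
  let h' := den n try_vertex h in
  holds_greedy h' (gtry K (hreg h 8)) /\ same_rest h h'.
Proof.
move=> e hadj ltv [gB gK gc] h'; rewrite /h' /try_vertex /gtry {h'}.
set v := hreg h 8 in ltv *.
rewrite den_seq den_load // ?(e 1) //; last by rewrite /=; lia.
rewrite den_if !hregE [_ == 9]/= [4 == 9]/= (e 4) // [nth _ _ _]/= gB //.
case: has => /=; first by split; [split=> //= | move=> r i].
rewrite /upd /= (e 2) // (e 4) //= ltv /=.
have -> /= : n + 2 < n + 4 by lia.
set h1 := hset _ _ _.
have e1 : env n h1 by do !apply: env_hset => //; apply: env_hput; apply: env_hset.
have v1 : hreg h1 (20 + D) = v by rewrite /= /upd eqxx.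
have m1 r i : hmem h1 r i = if (r == n + 2) && (i == v) then 1 else hmem h r i by [].
have M := @den_mark D h1 e1; rewrite v1 in M.
have {}M := M _ ltv.
have adj1 : holds_adj h1.
  by move=> x y ltx lty; rewrite m1 ifN ?hadj // negb_and; apply/orP; left; lia.
have {}M := M adj1.
split; last first.
  by move=> r i lti r1 r2; rewrite M // m1 (negPf r1) (negPf r2).
split=> [i lti|i lti|].
- rewrite M // eqxx andTb m1 (_ : (n + 1 == n + 2) = false) /=; last by lia.
  by rewrite gB //; case: reach.
- rewrite M // m1 (_ : (n + 2 == n + 1) = false) /=; last by lia.
  by rewrite eqxx /= gK // inE; case: eqP.
- rewrite den_frame; last by apply: mark_writes => //; lia.
  by rewrite /= /upd /= gc.
Qed.

Definition greedy_step (b : seq bool) K v := if nth false b v then gtry K v else K.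

(** The first pass accepts all of a scattered set; from any other set it drops the conflicting
    vertices, so the result is scattered for every [b] and enumerated sets need no test. The second
    pass makes it dominating. *)
Definition greedy (b : seq bool) : seq nat :=
  foldl gtry (foldl (greedy_step b) [::] (iota 0 n)) (iota 0 n).

Definition holds_row (h : hstate) (r : nat) (b : nat -> bool) : Prop :=
  forall i, i < n -> hmem h r i = b i.

Definition run_greedy : hprog :=
  HSeq (HConst 10 0)
  (HSeq (HFor 8 (HSeq (HStore 1 8 5) (HStore 2 8 5)))
  (HSeq (HFor 8 (HSeq (HLoad 9 0 8) (HIf 5 9 try_vertex HSkip)))
        (HFor 8 try_vertex))).

Lemma run_greedy_writes x : x < 20 -> x != 8 -> x != 9 -> x != 10 ->
  ~~ writes run_greedy x.
Proof.
move=> x20 x8 x9 x10.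
have /= := @try_writes x x9 x10 (_ : is_true _); rewrite leqNgt x20 => /(_ isT).
by rewrite (negPf x8) (negPf x9) (negPf x10) /= !orbF orbb.
Qed.

Lemma wf_run_greedy : wf run_greedy.
Proof.
have := @try_writes 8 isT isT isT; rewrite /= wf_mark orbF => w.
by rewrite (negPf w).
Qed.

Lemma den_run_greedy h b :
  env n h -> holds_adj h -> holds_row h n (nth false b) ->
  let h' := den n run_greedy h in
  holds_greedy h' (greedy b) /\ same_rest h h'.
Proof.
move=> e hadj hb; rewrite /run_greedy 3!den_seq.
set h1 := den n (HConst 10 0) h.
have e1 : env n h1 by apply: env_hset.
have [||h2 [-> fr2 [z2 c2 s2]]] := @for_ind n 8 (HSeq (HStore 1 8 5) (HStore 2 8 5)) h1
   (fun j h' => [/\ forall i, i < j -> hmem h' (n + 1) i = 0 /\ hmem h' (n + 2) i = 0,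
       hreg h' 10 = 0 & same_rest h h']).
- by split.
- move=> j h' ltj fr [z c s].
  have e' : env n h' by apply: env_frame e1 => x x8; apply: fr => //=; lia.
  rewrite /= /upd /= (e' 1) // (e' 5) //= ltj /=.
  rewrite (_ : n + 1 < n + 4) /=; last by lia.
  rewrite /upd /= (e' 2) // (e' 5) //= ltj (_ : n + 2 < n + 4) /=; last by lia.
  split=> // [i|r i lti r1 r2] /=.
    have [n1 n2] : (n + 1 == n + 2) = false /\ (n + 2 == n + 1) = false by lia.
    rewrite ltnS leq_eqVlt !eqxx n1 n2 /=.
    by case: eqP => //= _ /z [-> ->].
  by rewrite (negPf r1) (negPf r2) /= s.
set h3 := hset h2 8 n.
have e3 : env n h3.
  by apply: env_hset => //; apply: env_frame e1 => x x8; apply: fr2 => //=; lia.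
have g3 : holds_greedy h3 [::].
  by split=> //= i /z2[E1 E2]; rewrite ?E1 ?E2.
have [||h4 [-> fr4 [g4 s4]]] := @for_ind n 8
    (HSeq (HLoad 9 0 8) (HIf 5 9 try_vertex HSkip)) h3
   (fun j h' => holds_greedy h' (foldl (greedy_step b) [::] (iota 0 j)) /\ same_rest h h').
- by split.
- move=> j h' ltj fr [g s].
  have e' : env n h'.
    apply: env_frame e3 => x x8; apply: fr; first by lia.
    by apply/norP; split; [|apply/norP; split; [apply: try_writes|]] => //=; lia.
  rewrite iota0S foldl_rcons {1}/greedy_step.
  rewrite den_seq den_load !hregE ?eqxx //= (e' 0) //=; last by lia.
  rewrite /upd /= (e' 5) //=.
  rewrite s ?hb; try by lia.
  case: (nth false b j) => /=; last by [].
  pose h5 := hset (hset h' 8 j) 9 1.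
  have e5 : env n h5 by apply: env_hset => //; apply: env_hset.
  have [] := @den_try h5 (foldl (greedy_step b) [::] (iota 0 j)) e5 _ _ _ => //.
    exact: same_rest_adj s hadj.
  by move=> g5 s5; split=> //; apply: same_rest_trans s5.
set h5 := hset h4 8 n.
have e5 : env n h5.
  apply: env_hset => //; apply: env_frame e3 => x x8; apply: fr4; first by lia.
  by apply/norP; split; [|apply/norP; split; [apply: try_writes|]] => //=; lia.
have [||h6 [-> fr6 [g6 s6]]] := @for_ind n 8 try_vertex h5
   (fun j h' => holds_greedy h'
      (foldl gtry (foldl (greedy_step b) [::] (iota 0 n)) (iota 0 j)) /\ same_rest h h').
- by split.
- move=> j h' ltj fr [g s].
  have e' : env n h'.
    by apply: env_frame e5 => x x8; apply: fr; [lia | apply: try_writes; lia].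
  rewrite iota0S foldl_rcons.
  have e7 : env n (hset h' 8 j) by apply: env_hset.
  have [] := @den_try (hset h' 8 j) _ e7 _ _ g => //.
    exact: same_rest_adj s hadj.
  by move=> g7 s7; split=> //; apply: same_rest_trans s7.
by split.
Qed.

Definition update_best : hprog :=
  HIf 11 10 (HSeq (HCopy 11 10) (HFor 8 (HSeq (HLoad 9 2 8) (HStore 3 8 9)))) HSkip.

Lemma den_update_best h (S K : seq nat) :
  env n h -> holds_row h (n + 2) (mem K) -> holds_row h (n + 3) (mem S) ->
  hreg h 10 = size K -> hreg h 11 = size S ->
  let S' := if size S < size K then K else S in
  let h' := den n update_best h in
  [/\ holds_row h' (n + 3) (mem S'), hreg h' 11 = size S' &
      forall r i, r != n + 3 -> hmem h' r i = hmem h r i].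
Proof.
move=> e hK hS c10 c11 S' h'; rewrite /h' /S' den_if c10 c11 {S' h'}.
case: ifP => // _; rewrite den_seq.
set h1 := den n (HCopy _ _) h.
have e1 : env n h1 by apply: env_hset.
have [||h2 [-> fr2 [g2 s2]]] := @for_ind n 8 (HSeq (HLoad 9 2 8) (HStore 3 8 9)) h1
   (fun j h' => (forall i, i < j -> hmem h' (n + 3) i = (i \in K)) /\
       forall r i, r != n + 3 -> hmem h' r i = hmem h r i).
- by [].
- move=> j h' ltj fr [g s].
  have e' : env n h' by apply: env_frame e1 => x x8; apply: fr => //=; lia.
  rewrite den_seq den_load !hregE ?eqxx //= (e' 2) //=; last by lia.
  rewrite /upd /= (e' 3) //= ltj.
  have -> /= : n + 3 < n + 4 by lia.
  split=> [i|r i r3] /=; last by rewrite (negPf r3) /= s.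
  rewrite ltnS leq_eqVlt eqxx /=; case: eqP => [-> _|_ /= /g //].
  rewrite s; last by lia.
  by rewrite hK.
split=> //=.
by rewrite /upd /= (fr2 11) //= /upd /= c10.
Qed.

End Greedy.

(** * Enumerating the bit vectors of bounded weight *)

(** Compares the numbers with least significant bit first. *)
Fixpoint ltb (b c : seq bool) : bool :=
  match b, c with
  | x :: b', y :: c' => ltb b' c' || [&& b' == c', ~~ x & y]
  | _, _ => false
  end.

Lemma ltbb b : ltb b b = false.
Proof. by elim: b => //= x b ->; rewrite eqxx; case: x. Qed.

Lemma ltb_trans b c e : ltb b c -> ltb c e -> ltb b e.
Proof.
elim: b c e => [|x b IH] [|y c] [|z e] //= /orP[bc|/and3P[/eqP-> xF yT]].
  by case/orP=> [ce|/and3P[/eqP<- _ _]]; rewrite ?bc ?(IH _ _ bc ce).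
by case/orP=> [->//|/and3P[_ /negP]].
Qed.

Lemma ltb_total b c : size b = size c -> [\/ ltb b c, b = c | ltb c b].
Proof.
elim: b c => [|x b IH] [|y c] //=; first by constructor 2.
case=> /IH [bc|->|cb].
- by constructor 1; rewrite bc.
- rewrite !ltbb !eqxx /=; case: x; case: y; by [constructor 1|constructor 2|constructor 3].
- by constructor 3; rewrite cb.
Qed.

(** Modes of the successor scan: 0 skips the low zeros, 1 propagates a carry,
    2 copies the remaining bits. Starting in mode 0 adds the lowest set bit,
    starting in mode 1 adds one. *)
Definition scan_mode (f : nat) (x : bool) : nat :=
  match f with 0 => x | 1 => if x then 1 else 2 | _ => f end.

Definition scan_bit (f : nat) (x : bool) : bool :=
  match f with 0 => false | 1 => ~~ x | _ => x end.

Definition mode_at (f : nat) (b : seq bool) (j : nat) : nat :=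
  foldl scan_mode f (take j b).

Definition succ_bit (f : nat) (b : seq bool) (i : nat) : bool :=
  scan_bit (mode_at f b i) (nth false b i).

Definition succ_vec (f : nat) (b : seq bool) : seq bool := mkseq (succ_bit f b) (size b).

Lemma succ_vec_cons f x b :
  succ_vec f (x :: b) = scan_bit f x :: succ_vec (scan_mode f x) b.
Proof.
rewrite /succ_vec /mkseq /= -[1]/(1 + 0) iotaDl -map_comp.
by rewrite /succ_bit /mode_at /=; congr (_ :: _).
Qed.

Lemma mode_at_cons f x b :
  mode_at f (x :: b) (size (x :: b)) = mode_at (scan_mode f x) b (size b).
Proof. by []. Qed.

Lemma size_succ_vec f b : size (succ_vec f b) = size b.
Proof. by rewrite size_mkseq. Qed.

Lemma mode_atS f b j : j < size b ->
  mode_at f b j.+1 = scan_mode (mode_at f b j) (nth false b j).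
Proof. by move=> ltj; rewrite /mode_at (take_nth false) // foldl_rcons. Qed.

Lemma succ_vec2 b : succ_vec 2 b = b.
Proof. by elim: b => // x b IH; rewrite succ_vec_cons IH. Qed.

Lemma mode_at2 b j : mode_at 2 b j = 2.
Proof. by rewrite /mode_at; elim: (take j b). Qed.

Lemma mode_at_le2 f b j : f <= 2 -> mode_at f b j <= 2.
Proof.
rewrite /mode_at; elim: (take j b) f => //= x s IH f f2; apply: IH.
by case: f f2 => [|[|[]]] //=; case: x.
Qed.

(** Final mode 2 means that some zero bit absorbed the carry, so there is no overflow. That zero is
    the only bit that becomes set; in mode 0 the set bit that started the carry is cleared in
    exchange, so the weight does not grow. *)
Lemma succ_vec_gt f b : f <= 1 -> mode_at f b (size b) = 2 ->
  ltb b (succ_vec f b) /\ count id (succ_vec f b) <= count id b + f.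
Proof.
elim: b f => [|x b IH] f f1; first by case: f f1 => [|[]].
rewrite mode_at_cons succ_vec_cons.
case: f f1 => [|[]] //= _; case: x => /=.
- move/(IH 1 isT) => [-> /=]; lia.
- by move/(IH 0 isT) => [-> /=].
- move/(IH 1 isT) => [-> /=]; lia.
- by rewrite succ_vec2 eqxx orbT; split=> //; lia.
Qed.

(** Every number strictly between [b] and its mode 0 successor contains the set
    bits of [b] properly, hence has larger weight. *)
Lemma succ_vec_least f b c :
  size c = size b -> ltb b c -> f = 1 \/ f = 0 /\ count id c <= count id b ->
  mode_at f b (size b) = 2 /\ (ltb (succ_vec f b) c \/ succ_vec f b = c).
Proof.
elim: b f c => [|x b IH] f [|y c] // [sz] lt.
rewrite succ_vec_cons mode_at_cons; move: lt => /= lt.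
(* On a set low bit both modes do the same: clear it and add one to the rest. As the low bit of [b]
   is set, the comparison must already be decided by the higher bits. *)
have carry : x -> mode_at 1 b (size b) = 2 /\
    (ltb (false :: succ_vec 1 b) (y :: c) \/ false :: succ_vec 1 b = y :: c).
  move=> xT; move: lt; rewrite xT andbF orbF => lt.
  have [-> [H|->]] := IH 1 c sz lt (or_introl erefl); split=> //=.
    by left; rewrite H.
  by rewrite ltbb eqxx; case: y; [left|right].
case=> [->|[-> le_count]] /=; move: carry lt; last move: le_count.
all: case: x => /=.
- by move=> /(_ isT).
- move=> _ lt; rewrite mode_at2 succ_vec2; split=> //.
  by case/orP: lt => [->|/andP[/eqP-> ->]]; [left|right].
- by move=> _ /(_ isT).
(* Mode 0 skips a zero. If [c] agreed with [b] above it, the low bit of [c] would be set and its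
   weight too large. *)
- move=> le_count _ lt.
  have {}lt : ltb b c.
    case/orP: lt => // /andP[/eqP bc yT]; move: le_count; rewrite bc yT; lia.
  have le' : count id c <= count id b by apply: leq_trans le_count; apply: leq_addl.
  have [-> [H|bc]] := IH 0 c sz lt (or_intror (conj erefl le')).
    by split=> //; left; rewrite H.
  by split=> //; rewrite bc ltbb eqxx; case: y le_count; [left|right].
Qed.

(** * The successor vector on the machine, and the search loop *)

Fixpoint hadd (x c : nat) : hprog :=
  if c is c'.+1 then HSeq (HSucc x) (hadd x c') else HSkip.

Lemma hadd_writes x c y : y != x -> ~~ writes (hadd x c) y.
Proof. by move=> /negPf yx; elim: c => //= c IH; rewrite yx. Qed.

Lemma wf_hadd x c : wf (hadd x c).
Proof. by elim: c. Qed.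

Lemma hreg_hadd n x c h : hreg (den n (hadd x c) h) x = hreg h x + c.
Proof.
elim: c h => [|c IH] h /=; first by rewrite addn0.
by rewrite IH /= /upd eqxx addSnnS.
Qed.

Lemma hmem_hadd n x c h : hmem (den n (hadd x c) h) = hmem h.
Proof. by elim: c h => //= c IH h; rewrite IH. Qed.

Section Search.

Variables (n d : nat) (a : nat -> nat -> bool).

(** Register 12 holds the mode; registers 5, 4 and 7 hold the constants 0, 1 and 2 for the
    comparisons. *)
Definition scan_step : hprog :=
  HSeq (HLoad 9 0 8)
    (HIf 12 4 (HIf 5 9 (HSeq (HStore 0 8 5) (HConst 12 1)) HSkip)
       (HIf 12 7
          (HIf 5 9 (HStore 0 8 5) (HSeq (HStore 0 8 4) (HConst 12 2))) HSkip)).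

(** Register 13 collects [d * (weight + 1)] and register 6 holds [2 n + 1], so the comparison asks
    whether one more set bit stays within the budget. If so, one is added (mode 1), otherwise the
    lowest set bit (mode 0). A scan that ends below mode 2 has overflowed, and register 15 becomes
    the stop flag. *)
Definition next_vector : hprog :=
  HSeq (HConst 13 d)
  (HSeq (HFor 8 (HSeq (HLoad 9 0 8) (HIf 5 9 (hadd 13 d) HSkip)))
  (HSeq (HIf 13 6 (HConst 12 1) (HConst 12 0))
  (HSeq (HFor 8 scan_step)
        (HIf 12 7 (HConst 15 1) HSkip)))).

Definition start_mode (b : seq bool) : nat := d * (count id b).+1 <= n + n.

Lemma next_vector_writes x : x < 8 \/ x = 11 -> ~~ writes next_vector x.
Proof.
have H y : y != 13 -> writes (hadd 13 d) y = false by move=> ?; apply/negbTE/hadd_writes.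
case=> [x8|->]; rewrite /= H //; lia.
Qed.

Lemma wf_next_vector : wf next_vector.
Proof. by rewrite /= wf_hadd (negPf (hadd_writes _ _)). Qed.

Lemma den_next_vector h b :
  env n h -> size b = n -> holds_row n h n (nth false b) ->
  let f := start_mode b in
  let h' := den n next_vector h in
  [/\ holds_row n h' n (nth false (succ_vec f b)),
      forall r i, r != n -> hmem h' r i = hmem h r i &
      hreg h' 15 = if mode_at f b n < 2 then 1 else hreg h 15].
Proof.
move=> e sz hb f h'; rewrite /h' /next_vector 4!den_seq {h'}.
set h1 := den n (HConst 13 d) h.
have e1 : env n h1 by apply: env_hset.
have [||h2 [-> fr2 [w2 s2]]] := @for_ind n 8
   (HSeq (HLoad 9 0 8) (HIf 5 9 (hadd 13 d) HSkip)) h1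
   (fun j h' => hreg h' 13 = d * (count id (take j b)).+1 /\ hmem h' = hmem h).
- by rewrite take0 /= /upd /= muln1.
- move=> j h' ltj fr [w s].
  have e' : env n h'.
    apply: env_frame e1 => x x8; apply: fr; first by lia.
    by apply/norP; split; [|apply/norP; split; [apply: hadd_writes|]] => //=; lia.
  rewrite den_seq den_load !hregE ?eqxx //= (e' 0) //=; last by lia.
  rewrite /upd /= (e' 5) //= s hb // (take_nth false) ?sz // -cats1 count_cat /=.
  case: (nth false b j) => /=; last by rewrite !addn0.
  by rewrite hreg_hadd hmem_hadd /= /upd /= w; split=> //; nia.
set h3 := hset h2 8 n.
have e3 : env n h3.
  apply: env_hset => //; apply: env_frame e1 => x x8; apply: fr2; first by lia.
  by apply/norP; split; [|apply/norP; split; [apply: hadd_writes|]] => //=; lia.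
have h3_15 : hreg h3 15 = hreg h 15.
  rewrite /= /upd /= (fr2 15) //.
  by apply/norP; split; [|apply/norP; split; [apply: hadd_writes|]].
set h4 := den n (HIf _ _ _ _) h3.
have Eh4 : h4 = hset h3 12 f.
  rewrite /h4 den_if (e3 6) //= /upd /= w2 -{1}sz take_size ltnS /f /start_mode.
  by case: leqP.
have e4 : env n h4 by rewrite Eh4; apply: env_hset.
have [||h5 [-> fr5 [r5 m5 s5]]] := @for_ind n 8 scan_step h4
   (fun j h' => [/\ forall i, i < n ->
        hmem h' n i = if i < j then succ_bit f b i else nth false b i,
      hreg h' 12 = mode_at f b j & forall r i, r != n -> hmem h' r i = hmem h r i]).
- by split=> [i lti||r i rn]; rewrite Eh4 /= ?s2 ?hb // /mode_at take0.
- move=> j h' ltj fr [r m s].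
  have e' : env n h' by apply: env_frame e4 => x x8; apply: fr => //=; lia.
  rewrite /scan_step den_seq den_load !hregE ?eqxx //= (e' 0) //=; last by lia.
  rewrite /upd /= (e' 5) // (e' 4) // (e' 7) //= m r // ltnn mode_atS ?sz //.
  have rowE i : i < n ->
      nat_of_bool (if i < j.+1 then succ_bit f b i else nth false b i) =
      if i == j then nat_of_bool (scan_bit (mode_at f b j) (nth false b j))
      else hmem h' n i.
    by move=> lti; rewrite r // ltnS leq_eqVlt; case: eqP => [->|] //=.
  have f2 : f <= 2 by apply: leq_trans (leq_b1 _) _.
  have := mode_at_le2 b j f2.
  have rowj : hmem h' n j = nth false b j by rewrite r // ltnn.
  have n4 : n < n + 4 by lia.
  case: (mode_at f b j) m rowE => [|[|[|//]]] m rowE _;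
    case: (nth false b j) rowj rowE => rowj rowE /=;
    rewrite /upd /= ?(e' 0) //= ?ltj ?n4 /= ?(e' 4) ?(e' 5) //=;
    split=> [i lti||r' i r'n] //=;
    first [by rewrite ?(negPf r'n) /= s | rewrite ?eqxx rowE //=].
  1-3: by case: eqP => // ->.
have f2 : f <= 2 by apply: leq_trans (leq_b1 _) _.
have h5_15 : hreg h5 15 = hreg h 15 by rewrite (fr5 15) // Eh4 /= /upd.
have e5 : env n h5 by apply: env_frame e4 => x x8; apply: fr5 => //=; lia.
rewrite den_if !hregE /= m5 (e5 7) //=.
split.
- move=> i lti; rewrite nth_mkseq ?sz //.
  by case: ifP => _ /=; rewrite r5 // lti.
- by move=> r i rn; case: ifP => _ /=; rewrite s5.
- by case: ifP => _ /=; rewrite /upd /=.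
Qed.

Definition light (b : seq bool) : bool := d * count id b <= n + n.

Definition good (S : seq nat) : Prop := S = [::] \/ exists b, S = greedy n a d.-1 b.

(** Here [b] is the vector about to be processed. Its lightness belongs to the invariant because it
    bounds the number of rounds by the number of light vectors. *)
Definition search_inv (b : seq bool) (h : hstate) : Prop :=
  [/\ env n h, holds_adj n a h, holds_row n h n (nth false b), hreg h 15 = 0 &
   [/\ size b = n, light b & exists S,
     [/\ holds_row n h (n + 3) (mem S), hreg h 11 = size S, good S &
     forall c, size c = n -> light c -> ltb c b -> size (greedy n a d.-1 c) <= size S]]].

Definition search_done (h : hstate) : Prop :=
  env n h /\ exists S, [/\ holds_row n h (n + 3) (mem S), good S &
    forall c, size c = n -> light c -> size (greedy n a d.-1 c) <= size S].

Definition search_body : hprog :=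
  HSeq (run_greedy d.-1) (HSeq update_best next_vector).

Lemma wf_search_body : wf search_body.
Proof.
apply/andP; split; first exact: wf_run_greedy.
by apply/andP; split=> //; apply: wf_next_vector.
Qed.

Lemma den_search_body h b : search_inv b h ->
  let h' := den n search_body h in
  hreg h' 15 = 1 /\ search_done h' \/
  exists2 b', ltb b b' & search_inv b' h'.
Proof.
move=> [e hadj hb h15 [sz lb [S [hS h11 gS best]]]] h'.
rewrite /h' /search_body den_seq den_seq {h'}.
set h1 := den n (run_greedy _) h.
have [[_ hK h10] s1] : holds_greedy n a d.-1 h1 (greedy n a d.-1 b) /\ same_rest n h h1.
  exact: den_run_greedy.
set K := greedy n a d.-1 b in hK h10 *.
have w1 x : x < 20 -> x != 8 -> x != 9 -> x != 10 -> hreg h1 x = hreg h x.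
  by move=> *; apply: den_frame; apply: run_greedy_writes.
have e1 : env n h1 by apply: env_frame e => x x8; apply: w1; lia.
have hS1 : holds_row n h1 (n + 3) (mem S).
  by move=> i lti; rewrite s1 // ?hS //; lia.
have h11_1 : hreg h1 11 = size S by rewrite w1.
have [] := den_update_best e1 hK hS1 h10 h11_1.
set S' := if _ then _ else _; set h2 := den n update_best h1 => hS2 h11_2 s2.
have e2 : env n h2 by apply: env_den => // x x8 /=; lia.
have h15_2 : hreg h2 15 = 0.
  by rewrite /h2 den_frame // w1.
have hb2 : holds_row n h2 n (nth false b).
  by move=> i lti; rewrite s2 ?s1 ?hb //; lia.
have [] := den_next_vector e2 sz hb2.
set f := start_mode b; set h3 := den n next_vector h2 => hb3 s3 h15_3.
have e3 : env n h3 by apply: env_den => // x x8; apply: next_vector_writes; left.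
have hadj3 : holds_adj n a h3.
  by move=> u v ltu ltv; rewrite s3 ?s2 ?s1 ?hadj //; lia.
have hS3 : holds_row n h3 (n + 3) (mem S').
  by move=> i lti; rewrite s3 ?hS2 //; lia.
have h11_3 : hreg h3 11 = size S'.
  by rewrite /h3 den_frame //; apply: next_vector_writes; right.
have gS' : good S' by rewrite /S'; case: ifP => _ //; right; exists b.
have best' c : size c = n -> light c -> ltb c b \/ c = b ->
    size (greedy n a d.-1 c) <= size S'.
  move=> szc lc cb.
  have : size S <= size S' /\ size K <= size S'.
    by rewrite /S'; case: ltnP => cmp; split=> //; apply: ltnW.
  move=> [leS leK]; case: cb => [cb|->] //.
  exact: leq_trans (best _ szc lc cb) leS.
have f1 : f <= 1 by apply: leq_b1.
(* The start mode is 0 only if [d * (count id b).+1 > n + n]; a light [c] is then no heavier than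
   [b], as [succ_vec_least] requires. *)
have least c : size c = n -> light c -> ltb b c ->
    mode_at f b n = 2 /\ (ltb (succ_vec f b) c \/ succ_vec f b = c).
  move=> szc lc lt; rewrite -{1}sz; apply: succ_vec_least => //; first by rewrite sz.
  rewrite /f /start_mode; case: leqP => hw; [by left|right; split=> //].
  by move: lc hw; rewrite /light; nia.
case: ltnP h15_3 => mode h15_3.
  (* Overflow: by [least] no light vector lies above [b], so all of them have been covered. *)
  left; split=> //; split=> //; exists S'; split=> // c szc lc.
  apply: best' => //.
  have [|bc|->|cb] := @ltb_total b c; [by rewrite sz| |by right|by left].
  by have [m2 _] := least _ szc lc bc; rewrite m2 in mode.
have mode2 : mode_at f b (size b) = 2.
  by apply/eqP; rewrite eqn_leq sz mode andbT mode_at_le2 // (leq_trans f1).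
have [lt cnt] := succ_vec_gt f1 mode2.
right; exists (succ_vec f b) => //; split=> //; first by rewrite h15_3.
split; first by rewrite size_succ_vec.
  move: cnt lb; rewrite /light /f /start_mode; case: leqP => hw; nia.
exists S'; split=> // c szc lc lt'; apply: best' => //.
(* A light vector strictly between [b] and its successor would contradict [least]. *)
have [|bc|->|cb] := @ltb_total b c; [by rewrite sz| |by right|by left].
have [_ [H|H]] := least _ szc lc bc.
  by have := ltb_trans lt' H; rewrite ltbb.
by move: lt'; rewrite H ltbb.
Qed.

Definition search_setup : hprog :=
  HSeq (HFor 8 (HSeq (HSucc 0) (HSeq (HSucc 6) (HSucc 6))))
  (HSeq (HSucc 6)
  (HSeq (HCopy 1 0) (HSeq (HSucc 1)
  (HSeq (HCopy 2 1) (HSeq (HSucc 2)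
  (HSeq (HCopy 3 2) (HSeq (HSucc 3)
  (HSeq (HConst 4 1) (HConst 7 2))))))))).

Lemma den_search_setup h :
  (forall x, hreg h x = 0) -> holds_adj n a h ->
  (forall r i, i < n -> n <= r -> hmem h r i = 0) ->
  search_inv (nseq n false) (den n search_setup h).
Proof.
move=> z hadj hz.
have [||h' [Eh1 fr [r0 r6 m]]] := @for_ind n 8
  (HSeq (HSucc 0) (HSeq (HSucc 6) (HSucc 6))) h
  (fun j h' => [/\ hreg h' 0 = j, hreg h' 6 = j + j & hmem h' = hmem h]).
- by rewrite !z.
- move=> j h' ltj _ [r0 r6 m]; rewrite /= /upd /= r0 r6 m; split=> //; lia.
have f1 x : x != 0 -> x != 6 -> x != 8 -> hreg h' x = 0.
  by move=> x0 x6 x8; rewrite fr //= (negPf x0) (negPf x6).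
rewrite /search_setup den_seq Eh1 /=.
have row r b : n <= r -> (forall i, i < n -> b i = false) -> 
    forall i, i < n -> hmem h' r i = b i.
  by move=> nr b0 i lti; rewrite m hz // b0.
split=> //=.
- case=> [|[|[|[|[|[|[|[|x]]]]]]]] //= _; rewrite /upd /= ?r0 ?r6 ?f1 //; lia.
- by move=> u v ltu ltv; rewrite /= m hadj.
- by apply: row => // i lti; rewrite nth_nseq lti.
- by rewrite /upd /= f1.
split; first by rewrite size_nseq.
  by rewrite /light count_nseq mul0n muln0.
exists [::]; split=> //=; [|by rewrite /upd /= f1|by left|].
  by apply: row => //; lia.
(* Nothing precedes the zero vector, so optimality over the smaller vectors holds vacuously. *)
move=> c szc _ lt; exfalso; move: lt; rewrite -szc.
by elim: (c) => //= x s IH; case/orP => [/IH//|]; rewrite andbF andbF.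
Qed.

End Search.

(** * Balls and scattered sets *)

Section Balls.

Variables (G : sgraph) (a : nat -> nat -> bool).
Let n := nverts G.
Hypothesis aE : forall i j : 'I_n, a i j = adj i j.

Definition near (k : nat) (u v : 'I_n) : bool := reach n a k u v.

Lemma nearP k u v :
  reflect (exists p, [/\ path (@adj G) u p, last u p = v & size p <= k]) (near k u v).
Proof.
rewrite /near; elim: k u => [|k IH] u /=.
  rewrite orbF; apply: (iffP eqP) => [/val_inj->|[[|x p] [_ <- ?]]] //.
  by exists [::].
apply: (iffP orP) => [[/eqP/val_inj->|/hasP[x]]|[[|x p] [/= pth lst sz]]].
- by exists [::].
- rewrite mem_iota add0n => /andP[_ ltx] /andP[].
  rewrite -[x]/(val (Ordinal ltx)) aE => ux /IH[p [pth lst sz]].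
  by exists (Ordinal ltx :: p); rewrite /= ux.
- by left; rewrite lst.
- right; apply/hasP; exists (val x); first by rewrite mem_iota /=.
  have /andP[ux pth'] := pth.
  by rewrite aE ux /=; apply/IH; exists p.
Qed.

Lemma near_refl k u : near k u u.
Proof. exact: reach_refl. Qed.

Lemma near_mono j k u v : j <= k -> near j u v -> near k u v.
Proof.
by move=> jk /nearP[p [? ? sz]]; apply/nearP; exists p; split=> //; apply: leq_trans jk.
Qed.

Lemma near_trans j k u v w : near j u v -> near k v w -> near (j + k) u w.
Proof.
move=> /nearP[p [pth1 lst1 sz1]] /nearP[q [pth2 lst2 sz2]].
apply/nearP; exists (p ++ q); rewrite cat_path last_cat lst1 pth1 pth2 size_cat.
by split=> //; apply: leq_add.
Qed.

Lemma near_sym k u v : near k u v = near k v u.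
Proof.
suff imp x y : near k x y -> near k y x by apply/idP/idP; apply: imp.
move=> /nearP[p [pth lst sz]]; apply/nearP.
exists (rev (belast x p)); split; last by rewrite size_rev size_belast.
  by rewrite -lst rev_path (eq_path (e' := @adj G)) // => ? ?; rewrite adj_sym.
by case: p lst {pth sz} => //= z p; rewrite rev_cons last_rcons.
Qed.

Definition ball k u : {set 'I_n} := [set v | near k u v].

Lemma ball_grow k u : k < #|ball k u| \/ forall j, ball j u \subset ball k u.
Proof.
have sub j : ball j u \subset ball j.+1 u.
  by apply/subsetP => v; rewrite !inE; apply: near_mono.
elim: k => [|k [IH|IH]].
- by left; apply/card_gt0P; exists u; rewrite inE near_refl.
- have [closed|new] := boolP (ball k.+1 u \subset ball k u); last first.
    left; apply: leq_ltn_trans IH _; apply: proper_card.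
    by rewrite properE sub new.
  (* A walk of length at most [j.+1] reaches its last but one vertex inside [ball j u], hence inside
     [ball k.+1 u], hence by closedness inside [ball k u]; the last edge then ends in
     [ball k.+1 u]. *)
  right; elim=> [|j IHj].
    by apply/subsetP => v; rewrite !inE; apply: near_mono.
  apply/subsetP => w; rewrite inE => /nearP[p [pth lst sz]].
  have [->|ltp] : w = u \/ 0 < size p by case: p {pth sz} lst => [|? ?] /=; [left|right].
    by rewrite inE near_refl.
  case/lastP: p pth lst sz ltp => // p x; rewrite rcons_path last_rcons size_rcons.
  move=> /andP[pth xp] xw sz _; rewrite -xw.
  have /(subsetP IHj) /(subsetP closed) : last u p \in ball j u.
    by rewrite inE; apply/nearP; exists p.
  rewrite !inE => /near_trans H; rewrite -addn1; apply: H.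
  by apply/nearP; exists [:: x]; rewrite /= xp.
- by right=> j; apply: subset_trans (IH j) (sub k).
Qed.

Variable d : nat.
Hypothesis d_gt0 : 0 < d.

Lemma le_dist_near u v : le_dist d (gdist u v) = ~~ near d.-1 u v.
Proof.
rewrite /gdist.
(* [gdist] matches on [idP] itself, so the proof repeats that match with the boolean index
   abstracted. *)
refine (match idP as c in reflect _ _ return le_dist d
  (match c with ReflectT uv => Some (ex_minn (connect_walk uv)) | ReflectF _ => None end)
  = ~~ near d.-1 u v with ReflectT uv => _ | ReflectF nuv => _ end) => /=.
  case: ex_minnP => m wm minm; apply/idP/idP => [dm|].
    apply/negP => /nearP[p [pth lst sz]].
    have /minm : walk u v (size p).
      by apply/existsP; exists (in_tuple p); rewrite /= pth lst eqxx.
    by lia.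
  apply: contraR; rewrite -ltnNge => md.
  move: wm => /existsP[p /andP[pth /eqP lst]]; apply/nearP; exists p.
  by split=> //; rewrite size_tuple; lia.
symmetry; apply/negP => /nearP[p [pth lst _]]; apply: nuv.
by apply/connectP; exists p.
Qed.

Lemma scatteredE (K : {set 'I_n}) :
  scattered d K <-> {in K &, forall u v, near d.-1 u v -> u = v}.
Proof.
split=> scat u v uK vK.
  apply: contraTeq => uv; rewrite -le_dist_near; exact: scat.
by rewrite le_dist_near; apply: contra => /scat->.
Qed.

(** * Large and small balls around a scattered set *)

Let r := d.-1./2.

Definition big_part (K : {set 'I_n}) := [set v in K | d <= 2 * #|ball r v|].

Lemma double_r : r + r <= d.-1.
Proof. by rewrite /r; lia. Qed.

Lemma card_big_part (K : {set 'I_n}) : scattered d K -> d * #|big_part K| <= n + n.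
Proof.
move=> /scatteredE scat; rewrite addnn -mul2n.
apply: (@leq_trans (\sum_(v in big_part K) 2 * #|ball r v|)).
  rewrite mulnC -sum_nat_const; apply: leq_sum => v.
  by rewrite inE => /andP[].
rewrite -big_distrr /= leq_mul2l /=.
under eq_bigr do rewrite -sum1_card.
(* Double counting: each [w] lies in at most one of the balls, because two centres would be within
   [r + r <= d.-1] of each other and hence equal. *)
rewrite (exchange_big_dep predT) //= -[X in _ <= X]card_ord -sum1_card.
apply: leq_sum => w _; rewrite sum1_card; apply/card_le1_eqP => v u.
rewrite -!topredE /= !inE => /andP[/andP[vK _] vw] /andP[/andP[uK _] uw].
apply: scat => //; rewrite near_sym in vw.
exact: near_mono double_r (near_trans uw vw).
Qed.

(** The rounding in [r] still gives [d <= 2 * r.+1], so a ball with more than [r] vertices is never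
    small. Only the second alternative of [ball_grow] remains. *)
Lemma small_ball v j : 2 * #|ball r v| < d -> ball j v \subset ball r v.
Proof.
move=> small; have [|//] := ball_grow r v.
by move: small; rewrite /r; lia.
Qed.

(** There is an injection from [K] into [H]: vertices with a large ball stay, any other [v] goes to
    a vertex of [H] within [d.-1]. As the ball of [v] is already its component, that image is in
    fact within [r] of [v]. Two vertices with a common image are then within [r + r], hence
    equal. *)
Lemma dominating_card (K H : {set 'I_n}) :
  scattered d K -> big_part K \subset H ->
  (forall v, exists2 u, u \in H & near d.-1 u v) -> #|K| <= #|H|.
Proof.
move=> /scatteredE scat bigH dom.
pose f v := if v \in big_part K then v else odflt v [pick u in H | near d.-1 u v].
have fH v : f v \in H.
  rewrite /f; case: ifP => [/(subsetP bigH)//|_].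
  case: pickP => [u /andP[]//|/=]; have [u uH uv] := dom v.
  by move=> /(_ u); rewrite uH uv.
have f_near v : v \in K -> v \notin big_part K -> near r (f v) v.
  move=> vK; rewrite /f => vb; rewrite (negPf vb).
  move: vb; rewrite inE vK /= -ltnNge => /small_ball small.
  case: pickP => [u /andP[_ uv]|_]; last exact: near_refl.
  by rewrite near_sym; have := subsetP (small d.-1) u; rewrite !inE near_sym; apply.
have r_le : r <= d.-1 by rewrite /r; lia.
have f_inj : {in K &, injective f}.
  have aux u v : u \in K -> v \in K -> u \in big_part K -> v \notin big_part K ->
      f u = f v -> u = v.
    move=> uK vK ub vb; have := f_near v vK vb; rewrite /f ub => nv E.
    by apply: scat => //; apply: near_mono r_le _; rewrite E.
  move=> u v uK vK fuv.
  have [ub|ub] := boolP (u \in big_part K); have [vb|vb] := boolP (v \in big_part K).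
  - by move: fuv; rewrite /f ub vb.
  - exact: aux.
  - by symmetry; apply: aux.
  - have := f_near v vK vb; rewrite -fuv; have := f_near u uK ub.
    rewrite near_sym => n1 n2; apply: scat => //.
    exact: near_mono double_r (near_trans n1 n2).
rewrite -(card_in_imset f_inj); apply: subset_leq_card.
by apply/subsetP => _ /imsetP[v _ ->].
Qed.

(** * The greedy list as a vertex set *)

Definition vset (S : seq nat) : {set 'I_n} := [set i : 'I_n | val i \in S].

(** Each vertex is compared only with those accepted earlier, as in [gtry]; [near_sym] supplies the
    other direction in [indep_scattered]. *)
Fixpoint indep (S : seq nat) : bool :=
  if S is v :: S' then [&& v < n, ~~ has (fun u => reach n a d.-1 u v) S' & indep S']
  else true.

Lemma indep_gtry S v : v < n -> indep S -> indep (gtry n a d.-1 S v).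
Proof. by move=> ltv iS; rewrite /gtry; case: ifP => //= ->; rewrite ltv. Qed.

Lemma indep_greedy b : indep (greedy n a d.-1 b).
Proof.
have step (F : seq nat -> nat -> seq nat) s S :
    (forall S v, v < n -> indep S -> indep (F S v)) ->
    all (fun v => v < n) s -> indep S -> indep (foldl F S s).
  by move=> HF; elim: s S => //= v s IH S /andP[ltv als] iS; apply: IH => //; apply: HF.
have al : all (fun v => v < n) (iota 0 n).
  by apply/allP => v; rewrite mem_iota.
apply: (step) => //; first exact: indep_gtry.
apply: step => // S v ltv iS; rewrite /greedy_step; case: ifP => // _.
exact: indep_gtry.
Qed.

Lemma indep_lt S v : indep S -> v \in S -> v < n.
Proof.
elim: S => //= w S IH /and3P[ltw _ iS]; rewrite inE => /orP[/eqP->//|].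
exact: IH.
Qed.

Lemma indep_uniq S : indep S -> uniq S.
Proof.
elim: S => //= w S IH /and3P[_ hasw /IH->]; rewrite andbT.
by apply: contra hasw => wS; apply/hasP; exists w => //; apply: reach_refl.
Qed.

Lemma card_vset S : indep S -> #|vset S| = size S.
Proof.
move=> iS; rewrite cardE -(size_map val); apply: perm_size; apply: uniq_perm.
- by rewrite map_inj_uniq ?enum_uniq //; apply: val_inj.
- exact: indep_uniq.
- move=> x; apply/mapP/idP => [[i]|xS]; first by rewrite mem_enum inE => ? ->.
  by exists (Ordinal (indep_lt iS xS)); rewrite // mem_enum inE.
Qed.

Lemma indep_scattered S : indep S -> scattered d (vset S).
Proof.
move=> iS; apply/scatteredE => u v; rewrite !inE => uS vS uv; apply/val_inj => /=.
elim: S iS uS vS => //= w S IH /and3P[_ nw iS].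
rewrite !inE => /orP[/eqP uw|uS] /orP[/eqP vw|vS].
- by rewrite uw vw.
- case/hasP: nw; exists (val v) => //; rewrite -uw -/(near d.-1 v u).
  by rewrite near_sym.
- by case/hasP: nw; exists (val u); rewrite // -vw.
- exact: IH.
Qed.

Lemma sub_gtry S v : {subset S <= gtry n a d.-1 S v}.
Proof. by move=> x xS; rewrite /gtry; case: ifP => // _; rewrite inE xS orbT. Qed.

Lemma sub_foldl_gtry s S : {subset S <= foldl (gtry n a d.-1) S s}.
Proof. by elim: s S => [|v s IH] S x xS //=; apply: IH; apply: sub_gtry. Qed.

Lemma greedy_dominating b v : v < n ->
  exists2 u, u \in greedy n a d.-1 b & reach n a d.-1 u v.
Proof.
move=> ltv; rewrite /greedy; set S := foldl (greedy_step _ _ _ _) _ _.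
have : v \in iota 0 n by rewrite mem_iota.
elim: (iota 0 n) S => //= w s IH S; rewrite inE => /orP[/eqP<-|]; last exact: IH.
have [u uS uv] : exists2 u, u \in gtry n a d.-1 S v & reach n a d.-1 u v.
  rewrite /gtry; case: ifP => [/hasP//|_].
  by exists v; rewrite ?mem_head ?reach_refl.
by exists u => //; apply: sub_foldl_gtry.
Qed.

Lemma sub_greedy (X : {set 'I_n}) b :
  {in X &, forall u v, near d.-1 u v -> u = v} ->
  (forall i : 'I_n, nth false b i = (i \in X)) -> X \subset vset (greedy n a d.-1 b).
Proof.
move=> scat bE; apply/subsetP => v vX; rewrite inE; apply: sub_foldl_gtry.
(* Exact membership after [k] candidates: rejecting [k] would need an earlier [u] in [X] within
   [d.-1] of it, and [scat] forces [u = k]. *)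
suff H k : k <= n -> 
    foldl (greedy_step n a d.-1 b) [::] (iota 0 k) =i [pred x | nth false b x & x < k].
  by rewrite H // inE bE vX /=.
elim: k => [|k IH] ltk; first by move=> x; rewrite /= inE ltn0 andbF.
move=> x; rewrite iota0S foldl_rcons {1}/greedy_step.
set S := foldl _ _ _ in IH *; have {}IH := IH (ltnW ltk).
case: ifP => bk; last first.
  rewrite IH !inE ltnS [in RHS]leq_eqVlt; case: eqP => [->|//].
  by rewrite bk.
rewrite /gtry ifF; last first.
  apply/hasP => -[u]; rewrite IH inE => /andP[bu ltu] uk.
  have ltun := ltn_trans ltu ltk.
  have := scat (Ordinal ltun) (Ordinal ltk); rewrite -!bE.
  move=> /(_ bu bk uk) /(congr1 val) /= E.
  by rewrite E ltnn in ltu.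
rewrite inE IH !inE ltnS [in RHS]leq_eqVlt; case: eqP => [->|//].
by rewrite bk.
Qed.

Lemma greedy_optimal (K : {set 'I_n}) : scattered d K ->
  exists b, [/\ size b = n, light n d b & #|K| <= size (greedy n a d.-1 b)].
Proof.
move=> scatK; pose X := big_part K; pose b := [seq i \in X | i <- enum 'I_n].
have szb : size b = n by rewrite size_map size_enum_ord.
have bE (i : 'I_n) : nth false b i = (i \in X).
  by rewrite (nth_map i) ?size_enum_ord ?nth_ord_enum.
exists b; split=> //.
  rewrite /light count_map -size_filter.
  have -> : size [seq i <- enum 'I_n | preim (fun i => i \in X) id i] = #|X|.
    by rewrite cardE /= /enum_mem filter_predT.
  exact: card_big_part.
rewrite -(card_vset (indep_greedy b)); apply: dominating_card => //.
  apply: sub_greedy => // u v; rewrite !inE => /andP[uK _] /andP[vK _].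
  by apply: (scatteredE K).1.
move=> v; have [u uS uv] := greedy_dominating b (ltn_ord v).
have ltu := indep_lt (indep_greedy b) uS.
by exists (Ordinal ltu); rewrite ?inE.
Qed.

Lemma good_max_scattered S : good n d a S ->
  (forall c, size c = n -> light n d c -> size (greedy n a d.-1 c) <= size S) ->
  max_scattered d (vset S).
Proof.
move=> gS best.
have iS : indep S by case: gS => [->|[b ->]] //; apply: indep_greedy.
split=> [|K /greedy_optimal[b [szb lb le]]]; first exact: indep_scattered.
rewrite card_vset //; exact: leq_trans le (best _ szb lb).
Qed.

End Balls.

(** * Counting *)

Fixpoint allbits (n : nat) : seq (seq bool) :=
  if n is m.+1 then map (cons false) (allbits m) ++ map (cons true) (allbits m)
  else [:: [::]].

Lemma mem_allbits b : b \in allbits (size b).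
Proof.
elim: b => //= x b IH; rewrite mem_cat.
by case: x; rewrite (map_f _ IH) ?orbT.
Qed.

Lemma count_lt (T : eqType) (P Q : pred T) (s : seq T) x :
  subpred P Q -> x \in s -> Q x -> ~~ P x -> count P s < count Q s.
Proof.
move=> PQ + Qx Px; elim: s => //= y s IH; rewrite inE => /orP[/eqP<-|/IH lt].
  by rewrite Qx (negPf Px) add0n add1n ltnS; apply: sub_count.
by apply: leq_ltn_trans (_ : Q y + count P s < _); rewrite ?leq_add2r ?ltn_add2l //;
   case: (P y) (PQ y) => // ->.
Qed.

Section CountLight.

Import Order.TTheory GRing.Theory Num.Theory.
Local Open Scope ring_scope.

(** The generating function of the weight, used at [x = 1 / d] in [count_light]: a first bit
    contributes a factor 1 or [x]. *)
Lemma sum_allbits (R : comPzSemiRingType) n (x : R) :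
  \sum_(b <- allbits n) x ^+ count id b = (1 + x) ^+ n.
Proof.
elim: n => [|n IH] /=; first by rewrite big_seq1.
rewrite big_cat !big_map /= exprS mulrDl mul1r; congr (_ + _); first exact: IH.
by rewrite -IH mulr_sumr; apply: eq_bigr => b _; rewrite exprS.
Qed.

Lemma count_light (R : realType) (n d : nat) : (0 < d)%N ->
  (count (light n d) (allbits n))%:R <= powR (expR 1 * d%:R) (2 * n%:R / d%:R) :> R.
Proof.
move=> d0; set y : R := 2 * n%:R / d%:R.
have dR : (0 : R) < d%:R by rewrite ltr0n.
have dge0 : (0 : R) <= d%:R by apply: ltW.
have d1 : (1 : R) <= d%:R by rewrite ler1n.
(* Lightness says that the weight is at most [y], so [d ^ (y - weight)] is at least 1; summing over
   all vectors bounds the count. *)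
have term b : light n d b -> (1 : R) <= powR d%:R y * d%:R^-1 ^+ count id b.
  move=> lb; rewrite exprVn ler_pdivlMr ?exprn_gt0 // mul1r -powR_mulrn //.
  apply: ler_powR => //; rewrite /y ler_pdivlMr // -!natrM ler_nat mulnC.
  by rewrite mul2n -addnn.
apply: (@le_trans _ _ (powR d%:R y * (1 + d%:R^-1) ^+ n)).
  rewrite -sum_allbits mulr_sumr -sum1_count natr_sum big_mkcond /=.
  apply: ler_sum => b _; case: ifP => [/term//|_].
  by rewrite mulr_ge0 ?powR_ge0 // exprn_ge0 // invr_ge0.
rewrite powRM ?expR_ge0 ?ler0n // mulrC ler_wpM2r ?powR_ge0 //.
rewrite -expRM mul1r.
(* From [1 + 1 / d <= e ^ (1 / d)]. The result [e ^ (n / d)] uses only half of the available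
   exponent. *)
apply: (@le_trans _ _ (expR d%:R^-1 ^+ n)).
  by apply: lerXn2r; rewrite ?nnegrE ?expR_ge0 ?expR_ge1Dx ?addr_ge0 ?invr_ge0.
rewrite -expRM_natl ler_expR /y ler_wpM2r ?invr_ge0 //.
by rewrite -natrM ler_nat leq_pmull.
Qed.

End CountLight.

(** * The machine program *)

Section Program.

Variables (n d : nat) (a : nat -> nat -> bool).

(** A bound on the rounds still to come. A light [b] counts itself, since [ltb] is irreflexive, so
    moving on to a larger vector strictly decreases it. *)
Definition later_count (b : seq bool) : nat :=
  count (fun c => light n d c && ~~ ltb c b) (allbits n).

Lemma later_count_lt b b' : size b = n -> light n d b -> ltb b b' ->
  later_count b' < later_count b.
Proof.
move=> sz lb bb'; apply: (@count_lt _ _ _ _ b); rewrite ?lb ?bb' ?ltbb //.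
  move=> c /andP[-> nc] /=; apply: contra nc => cb; exact: ltb_trans cb bb'.
by rewrite -sz mem_allbits.
Qed.

(** Machine registers 20 and 9 are language registers 15, the stop flag, and 4, the constant 1. *)
Definition main_loop : prog := WhileLt 20 9 (compile (search_body d)).

Lemma runs_main_loop b h s :
  search_inv n d a b h -> represents n h s ->
  runs main_loop s (later_count b * (htime (search_body d) n).+1 + 1)
    (fun s' => exists2 h', represents n h' s' & search_done n d a h').
Proof.
set T := htime _ _; move: (leqnn (later_count b)); move: {2 3}(later_count b) => m.
elim: m b h s => [|m IH] b h s lem inv rep.
  (* This case is impossible: the light vector [b] is itself counted in [later_count b]. *)
  have [_ _ _ _ [sz lb _]] := inv.
  move: lem; rewrite leqn0 => /eqP/eqP; rewrite -leqn0 leqNgt -has_count => /hasP[].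
  by exists b; [rewrite -sz mem_allbits | rewrite /= lb ltbb].
have [e _ _ h15 [sz lb _]] := inv; have [_ _ sr _] := rep.
have lt1 : reg s 20 < reg s 9 by rewrite (sr 15) (sr 4) h15 (e 4).
have [t1 [s1 [ex1 le1 rep1]]] := runs_compile (wf_search_body d) rep.
have [[d15 sd]|[b' bb' inv']] := den_search_body inv.
  have [e1 _] := sd; have [_ _ sr1 _] := rep1.
  exists (t1 + 1).+1, s1; split; last by exists (den n (search_body d) h).
    apply: exec_WhileStep ex1 _ => //; apply: exec_WhileDone.
    by rewrite (sr1 15) (sr1 4) d15 (e1 4).
  by rewrite mulSn; rewrite -/T in le1; lia.
have ltb' := later_count_lt sz lb bb'.
have [|t2 [s2 [ex2 le2 q2]]] := IH b' _ _ _ inv' rep1.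
  by rewrite -ltnS; apply: leq_trans ltb' lem.
exists (t1 + t2).+1, s2; split=> //; first exact: exec_WhileStep ex1 ex2.
by rewrite mulSn; rewrite -/T in le1; lia.
Qed.

Definition load_input : prog :=
  Seq (Read 3 0) (Seq (Copy 4 3) (Seq (Succ 4) (Seq (Succ 4) (Seq (Succ 4) (Succ 4))))).

Lemma runs_load_input s : (forall x, reg s x = 0) -> ram s 0 = n ->
  runs load_input s 6 (represents n
    (HState (fun=> 0) (fun r i => ram s (1 + r * n + i)))).
Proof.
move=> z s0.
exists (1 + (1 + (1 + (1 + (1 + 1))))); eexists; split=> //.
  by do 5 ![apply: exec_Seq; first by constructor]; constructor.
rewrite /set_reg /= /upd /= z s0; split=> //=; first by lia.
by move=> x; rewrite ifN ?ifN //; lia.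
Qed.

(** Machine register 8 is language register 3 and holds the row number [n + 3] of the best set.
    Registers 13 and 14 can be reused, as the search is over. *)
Definition write_output : prog :=
  Loop 13 3 (Seq (Addr 8 13) (Seq (Read 14 0) (Write 13 14))).

Lemma runs_write_output h s (S : nat -> bool) :
  represents n h s -> env n h -> holds_row n h (n + 3) S ->
  runs write_output s (n * (addr_time n (n + 3) n + 2).+2 + 2)
    (fun s' => forall i, i < n -> ram s' i = S i).
Proof.
move=> [s3 s4 sr sm] e hS.
pose I j s' := [/\ reg s' 13 = j, reg s' 3 = n, reg s' 8 = n + 3,
  forall i, i < n -> ram s' (1 + (n + 3) * n + i) = S i &
  forall i, i < j -> ram s' i = S i].
apply: runs_weaken (_ : runs _ _ _ (I n)) (leqnn _) _; last by move=> s' [].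
apply: (@runs_loop 13 3 _ n (addr_time n (n + 3) n + 2) I).
- by move=> j s' [].
- move=> j s' ltj [r13 r3 r8 hrow out].
  apply: (@runs_seq _ _ _ _ 2 (fun s2 =>
    same_above2 s' s2 /\ reg s2 0 = 1 + (n + 3) * n + j)).
    have := @runs_addr n 8 13 s' isT isT r3; rewrite r8 r13 => H.
    by apply: runs_weaken H _ (fun _ => id); apply: addr_time_mono => //; apply: ltnW.
  move=> s2 [[Em Er] r0].
  apply: (@runs_seq _ _ _ 1 1) (fun _ => id).
  apply: runs_read; apply: runs_write.
  rewrite r0 Em hrow //; split=> [||||i] /=; rewrite /upd /= ?Er ?r13 ?Em //.
    (* The source row starts beyond the first [n] cells, so it survives the writes. *)
    by move=> i lti; rewrite ifN ?hrow //; nia.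
  by rewrite ltnS leq_eqVlt; case: eqP => [->|_ /= /out].
- split=> //=; rewrite /upd /=.
    by rewrite (sr 3) (e 3).
  by move=> i lti; rewrite sm // hS.
Qed.

End Program.

Lemma nth_allpairs (S T : Type) (f : S -> T -> nat) (x0 : S) (y0 : T) s t i j :
  i < size s -> j < size t ->
  nth 0 [seq f x y | x <- s, y <- t] (i * size t + j) = f (nth x0 s i) (nth y0 t j).
Proof.
move=> + ltj; elim: s i => //= x s IH [|i] lti; rewrite nth_cat size_map.
  by rewrite ltj (nth_map y0).
by rewrite mulSn -addnA ltnNge leq_addr /= addKn IH.
Qed.

Definition adj_code (G : sgraph) (u v : nat) : bool :=
  nth 0 (encode G) (1 + u * nverts G + v) != 0.

Lemma nth_encode (G : sgraph) (i j : 'I_(nverts G)) :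
  nth 0 (encode G) (1 + i * nverts G + j) = adj i j.
Proof.
rewrite /encode -addnA add1n /= -[X in _ * X + _](size_enum_ord (nverts G)).
by rewrite (nth_allpairs _ i j) ?size_enum_ord // !nth_ord_enum.
Qed.

Lemma adj_codeE (G : sgraph) (i j : 'I_(nverts G)) : adj_code G i j = adj i j.
Proof. by rewrite /adj_code nth_encode; case: adj. Qed.

Lemma size_encode (G : sgraph) : size (encode G) = 1 + nverts G * nverts G.
Proof. by rewrite /= size_allpairs size_enum_ord. Qed.

Definition solver (d : nat) : prog :=
  Seq load_input (Seq (compile search_setup) (Seq (main_loop d) write_output)).

Definition solver_overhead (d n : nat) : nat :=
  6 + htime search_setup n + (htime (search_body d) n + 2)
  + (n * (addr_time n (n + 3) n + 4) + 2).

Lemma runs_solver (d : nat) (G : sgraph) : 0 < d ->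
  runs (solver d) (start (encode G))
    (solver_overhead d (nverts G) * count (light (nverts G) d) (allbits (nverts G)))
    (solves_scattered d G).
Proof.
move=> d0; set n := nverts G; set C := count _ _.
pose b0 := nseq n false.
(* The zero vector is light. With [C >= 1] the costs outside the main loop can be charged to the
   product as well. *)
have C1 : 0 < C.
  rewrite -has_count; apply/hasP; exists b0.
    by have := mem_allbits b0; rewrite size_nseq.
  by rewrite /light count_nseq mul0n muln0.
have leC : later_count n d b0 <= C by apply: sub_count => c /andP[].
set s0 := start _.
pose h0 := HState (fun=> 0) (fun r i => ram s0 (1 + r * n + i)).
have inv0 : search_inv n d (adj_code G) b0 (den n search_setup h0).
  apply: den_search_setup => //.
    move=> u v ltu ltv; have E := nth_encode (Ordinal ltu) (Ordinal ltv).
    by apply: etrans E _; rewrite -adj_codeE.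
  by move=> r i lti ler; apply: nth_default; rewrite size_encode -/n; nia.
apply: (@runs_weaken _ _ (6 + (htime search_setup n +
   ((later_count n d b0 * (htime (search_body d) n).+1 + 1)
   + (n * (addr_time n (n + 3) n + 2).+2 + 2))))
   _ (fun s' => exists S : seq nat, [/\ forall i, i < n -> ram s' i = (i \in S),
     good n d (adj_code G) S &
     forall c, size c = n -> light n d c -> size (greedy n (adj_code G) d.-1 c) <= size S])).
- apply: (@runs_seq _ _ _ _ _ (represents n h0)); first exact: runs_load_input.
  move=> s1 rep1; apply: runs_seq (runs_compile _ rep1) _ => // s2 rep2.
  apply: runs_seq (runs_main_loop inv0 rep2) _ => s3 [h3 rep3 [e3 [S [hS gS best]]]].
  apply: runs_weaken (runs_write_output rep3 e3 hS) _ _ => // s4 out.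
  by exists S.
- rewrite /solver_overhead -/n.
  set x := htime _ _; set y := htime _ _; set z := addr_time _ _ _.
  have leM : later_count n d b0 * y.+1 <= C * y.+1 by rewrite leq_mul2r leC orbT.
  have : 6 + x + 1 + (n * (z + 4) + 2) <= (6 + x + 1 + (n * (z + 4) + 2)) * C.
    by rewrite leq_pmulr.
  rewrite (_ : n * (z + 2).+2 = n * (z + 4)); last by lia.
  by move: leM; set w := n * _; nia.
- move=> s' [S [out gS best]]; rewrite /solves_scattered.
  have -> : answer G s' = vset G S.
    apply/setP => i; rewrite !inE out //.
    by case: (_ \in _).
  by apply: good_max_scattered gS best => //; apply: adj_codeE.
Qed.

Lemma poly_bounded_solver_overhead d : poly_bounded (solver_overhead d).
Proof.
rewrite /solver_overhead.
apply: poly_bounded_add.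
  apply: poly_bounded_add; apply: poly_bounded_add;
    by [apply: poly_bounded_const | apply: poly_bounded_htime].
apply: poly_bounded_add; last exact: poly_bounded_const.
apply: poly_bounded_mul; first exact: poly_bounded_id.
exact: poly_bounded_addr_time.
Qed.

Theorem theorem6 (R : realType) (d : nat) (hd : (2 <= d)%N) :
  solvable_Ostar encode (solves_scattered d)
    (fun G => (powR (expR 1 * d%:R) (2 * (nverts G)%:R / d%:R) : R)%R).
Proof.
have d0 : 0 < d by apply: ltnW.
have [p Hp] := poly_bounded_solver_overhead d.
exists (solver d), p => G.
have [t [s [ex le_t sol]]] := runs_solver G d0.
exists t, s; split=> //.
set n := nverts G in le_t *.
apply: (@Order.POrderTheory.le_trans _ _
  ((p.[size (encode G)] * count (light n d) (allbits n))%N%:R)%R).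
  rewrite Num.Theory.ler_nat; apply: leq_trans le_t _; rewrite leq_mul2r.
  apply/orP; right; apply: leq_trans (Hp n) (poly_nat_mono _ _).
  by rewrite size_encode -/n; nia.
rewrite GRing.natrM Num.Theory.ler_wpM2l ?Num.Theory.ler0n //.
exact: count_light.
Qed.
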